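(* Let $H$ be the Heisenberg group and let $V\subset T_{\mathbb C}H$ be the left-invariant complex line bundle spanned at the identity $e\in H$ by $$L=\begin{pmatrix}0&1&0\\0&0&i\\0&0&0\end{pmatrix}\in\mathfrak h\otimes\mathbb C.$$ Then: (a) $V$ is the unique left-invariant CR structure on $H$, up to the action of $\mathrm{Aut}(H)$. (b) $V$ is spherical, CR equivalent to the complement of a point in $S^3$. (c) $V$ is also embeddable in $\mathbb C^2$ as the real quadric $\mathrm{Im}(z_1)=|z_2|^2$. In these coordinates, the group multiplication in $H$ is given by $$(z_1,z_2)\cdot(w_1,w_2)=(z_1+w_1+2i\,\bar z_2w_2,\ z_2+w_2).$$
   Context: The Heisenberg group $H$ is the group of real matrices $\begin{pmatrix}1&x&z\\0&1&y\\0&0&1\end{pmatrix}$; its Lie algebra $\mathfrak h$ consists of the real matrices $\begin{pmatrix}0&a&c\\0&0&b\\0&0&0\end{pmatrix}$. $\mathrm{Aut}(H)$ is its group of Lie group automorphisms. All CR structures are on smooth 3-manifolds and are non-degenerate. A CR structure on a 3-manifold $M$ is a complex line subbundle $V\subset T_{\mathbb C}M:=TM\otimes\mathbb C$ such that $V\cap\overline V=\{0\}$ and the sections of $V\oplus\overline V$ bracket-generate $T_{\mathbb C}M$. A real hypersurface $M$ in a complex 2-manifold $N$ carries the induced structure $V=T_{\mathbb C}M\cap T^{(0,1)}N$; this applies to the unit sphere $S^3\subset\mathbb C^2$ and to the quadric in (c). A CR equivalence is a diffeomorphism $f$ with $(\mathrm df)_{\mathbb C}V_1=V_2$. A CR structure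 is spherical if every point has a neighborhood CR equivalent to an open subset of $S^3$. A CR structure on a Lie group is left-invariant if all left translations are CR equivalences. Statement (c) means that there is a CR equivalence from $(H,V)$ onto the quadric which carries the product of $H$ to the displayed product. *)

(* Defs.v *)
From HB Require Import structures.
From mathcomp Require Import all_boot all_order all_algebra.
From mathcomp Require Import all_classical all_reals all_analysis.
From mathcomp Require Import complex.

Set Implicit Arguments.
Unset Strict Implicit.
Unset Printing Implicit Defensive.

Import Order.TTheory GRing.Theory Num.Theory.
Import numFieldNormedType.Exports.

Local Open Scope classical_set_scope.
Local Open Scope ring_scope.

(* Manifolds are embedded submanifolds of normed spaces: a manifold is a set
   [M : set E] with [submanifold k M], and a map between manifolds is a total
   function between the ambient spaces, of which only the values on the source
   matter. *)

Section SmoothMaps.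
Variable R : realType.

Definition smooth (E F : normedModType R) (U : set E) (f : E -> F) : Prop :=
  open U /\ forall (vs : seq E) (x : E), U x ->
    differentiable (foldr (fun v g => 'D_v g) f vs) x.

Definition local_extension (E F : normedModType R) (A : set E) (f : E -> F)
    (p : E) : set (E -> F) :=
  [set g | exists U : set E,
     [/\ U p, smooth U g & forall x, A x -> U x -> g x = f x]].

Definition smooth_map (E F : normedModType R) (A : set E) (f : E -> F) : Prop :=
  forall p, A p -> local_extension A f p !=set0.

Definition diffeomorphism (E F : normedModType R) (A : set E) (B : set F)
    (f : E -> F) : Prop :=
  [/\ smooth_map A f, forall x, A x -> B (f x) &
     exists g : F -> E,
       [/\ smooth_map B g, forall y, B y -> A (g y),
           forall x, A x -> g (f x) = x & forall y, B y -> f (g y) = y]].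

Definition submanifold (E : normedModType R) (k : nat) (M : set E) : Prop :=
  forall p, M p -> exists (U : set E) (W : set 'rV[R]_k) (phi : 'rV[R]_k -> E),
    [/\ open U, U p, open W & diffeomorphism W (M `&` U) phi].

Definition tangent (E : normedModType R) (M : set E) (p : E) : set E :=
  [set v | exists (I : set R^o) (gamma : R^o -> E),
     [/\ I 0, smooth I gamma, forall t, I t -> M (gamma t), gamma 0 = p
       & 'd gamma 0 1 = v]].

(* On [tangent A p], with [A] a submanifold and [f] smooth on [A], the value
   does not depend on the extension chosen. *)
Definition differential (E F : normedModType R) (A : set E) (f : E -> F)
    (p : E) : E -> F :=
  'd (xget f (local_extension A f p)) p.

End SmoothMaps.

Section CRStructures.
Variable R : realType.

(* E * E stands for the complexification of E: the pair (u, v) is u + i v. *)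

Definition cplx_scale (E : normedModType R) (c : R[i]) (w : E * E) : E * E :=
  (complex.Re c *: w.1 - complex.Im c *: w.2,
   complex.Re c *: w.2 + complex.Im c *: w.1).

Definition cplx_conj (E : normedModType R) (w : E * E) : E * E := (w.1, - w.2).

Definition ctangent (E : normedModType R) (M : set E) (p : E) : set (E * E) :=
  [set w | tangent M p w.1 /\ tangent M p w.2].

Definition cdifferential (E F : normedModType R) (A : set E) (f : E -> F)
    (p : E) (w : E * E) : F * F :=
  (differential A f p w.1, differential A f p w.2).

(* The complex-linear extension in [w] of the differential of a function with
   values in the complex space F (x) C. *)
Definition cderivative (E F : normedModType R) (A : set E) (X : E -> F * F)
    (p : E) (w : E * E) : F * F :=
  differential A X p w.1 + cplx_scale 'i (differential A X p w.2).

Definition bracket (E : normedModType R) (A : set E) (X Y : E -> E * E)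
    (p : E) : E * E :=
  cderivative A Y p (X p) - cderivative A X p (Y p).

(* A subbundle is given by its fibres [V p], which are only meaningful at points
   p of M. *)
Definition complex_line_subbundle (E : normedModType R) (M : set E)
    (V : E -> set (E * E)) : Prop :=
  forall p, M p -> exists (U : set E) (L : E -> E * E),
    [/\ open U, U p, smooth_map (M `&` U) L &
     forall q, M q -> U q ->
       [/\ ctangent M q (L q), L q != 0 & V q = [set cplx_scale c (L q) | c in setT]]].

Definition section_VVbar (E : normedModType R) (A : set E)
    (V : E -> set (E * E)) (X : E -> E * E) : Prop :=
  smooth_map A X /\
  forall q, A q -> exists u v, [/\ V q u, V q v & X q = u + cplx_conj v].

Inductive generated_field (E : normedModType R) (A : set E)
    (V : E -> set (E * E)) : (E -> E * E) -> Prop :=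
| generated_section X : section_VVbar A V X -> generated_field A V X
| generated_add X Y : generated_field A V X -> generated_field A V Y ->
    generated_field A V (fun p => X p + Y p)
| generated_scale c X : generated_field A V X ->
    generated_field A V (fun p => cplx_scale c (X p))
| generated_bracket X Y : generated_field A V X -> generated_field A V Y ->
    generated_field A V (bracket A X Y).

Definition bracket_generating (E : normedModType R) (M : set E)
    (V : E -> set (E * E)) : Prop :=
  forall p w, M p -> ctangent M p w ->
    exists (U : set E) (X : E -> E * E),
      [/\ open U, U p, generated_field (M `&` U) V X & X p = w].

Definition CR_structure (E : normedModType R) (M : set E)
    (V : E -> set (E * E)) : Prop :=
  [/\ submanifold 3 M, complex_line_subbundle M V,
      forall p, M p -> V p `&` (@cplx_conj E @` V p) = [set 0] &
      bracket_generating M V].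

Definition CR_equivalence (E F : normedModType R) (M : set E)
    (V : E -> set (E * E)) (N : set F) (W : F -> set (F * F))
    (f : E -> F) : Prop :=
  diffeomorphism M N f /\
  forall p, M p -> cdifferential M f p @` V p = W (f p).

Definition left_invariant (E : normedModType R) (G : set E)
    (mul : E -> E -> E) (V : E -> set (E * E)) : Prop :=
  forall g, G g -> CR_equivalence G V G V (mul g).

Definition lie_automorphism (E : normedModType R) (G : set E)
    (mul : E -> E -> E) (phi : E -> E) : Prop :=
  diffeomorphism G G phi /\
  forall g h, G g -> G h -> phi (mul g h) = mul (phi g) (phi h).

(* C^2, as a real normed space, with each coordinate given by its real and
   imaginary parts. *)
Definition C2 : normedModType R := ((R^o * R^o) * (R^o * R^o))%type.

Definition z1 (p : C2) : R[i] := Complex p.1.1 p.1.2.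
Definition z2 (p : C2) : R[i] := Complex p.2.1 p.2.2.

Definition mkC2 (a b : R[i]) : C2 :=
  ((complex.Re a, complex.Im a), (complex.Re b, complex.Im b)).

Definition J (p : C2) : C2 := mkC2 ('i * z1 p) ('i * z2 p).

(* The (-i)-eigenspace of the complex-linear extension of J. *)
Definition T01 : set (C2 * C2) := [set w | (J w.1, J w.2) = cplx_scale (- 'i) w].

Definition induced_CR (M : set C2) (p : C2) : set (C2 * C2) :=
  ctangent M p `&` T01.

Definition S3 : set C2 := [set p | `|z1 p| ^+ 2 + `|z2 p| ^+ 2 = 1].

Definition spherical (E : normedModType R) (M : set E)
    (V : E -> set (E * E)) : Prop :=
  forall p, M p -> exists (U : set E) (W : set C2) (f : E -> C2),
    [/\ open U, U p, open W &
        CR_equivalence (M `&` U) V (S3 `&` W) (induced_CR (S3 `&` W)) f].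

Definition quadric : set C2 := [set p | 'Im (z1 p) = `|z2 p| ^+ 2].

Definition quadric_mul (z w : C2) : C2 :=
  mkC2 (z1 z + z1 w + 2 * 'i * (z2 z)^* * z2 w) (z2 z + z2 w).

Definition heisenberg : set 'M[R]_3 :=
  [set g | exists x y z : R,
     g = 1%:M + x *: delta_mx 0 1 + y *: delta_mx 1 2%:R + z *: delta_mx 0 2%:R].

Definition heisenberg_L : 'M[R]_3 * 'M[R]_3 :=
  let L : 'M[R[i]]_3 := delta_mx 0 1 + 'i *: delta_mx 1 2%:R in
  (map_mx (@complex.Re R) L, map_mx (@complex.Im R) L).

Definition heisenberg_V (g : 'M[R]_3) : set ('M[R]_3 * 'M[R]_3) :=
  cdifferential heisenberg (mulmx g) 1%:M @`
    [set cplx_scale c heisenberg_L | c in setT].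

End CRStructures.

Arguments S3 {R}.
Arguments quadric {R}.
Arguments heisenberg {R}.
Arguments heisenberg_V {R}.

(* Main.v *)
From HB Require Import structures.
Require Import Defs.
From mathcomp Require Import all_boot all_order all_algebra.
From mathcomp Require Import all_classical all_reals all_analysis.
From mathcomp Require Import complex.
From mathcomp Require Import ring lra.
Import Order.TTheory GRing.Theory Num.Theory.
Import numFieldNormedType.Exports.
Local Open Scope classical_set_scope.
Local Open Scope ring_scope.

Set Implicit Arguments.
Unset Strict Implicit.
Unset Printing Implicit Defensive.

(** The Lie algebra of the Heisenberg group has the basis [X], [Y], [Z] with
    [[X, Y] = Z] central, and [L = X + i Y].

    Uniqueness is a matter of linear algebra.  A left-invariant CR structure is
    spanned at the identity by one vector [w1 + i w2] ([invariant_CR_line]).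
    Bracket generation forces [[w1, w2]] to be nonzero: otherwise [w1] and [w2]
    lie in a proper ideal, whose left-invariant distribution is closed under
    brackets ([generated_field_kernel], [bracket_generating_det]).  Then
    [X |-> w1], [Y |-> w2], [Z |-> [w1, w2]] is a Lie algebra automorphism; it
    integrates to a polynomial automorphism of the group ([heis_hom]), which
    carries the line of [L] to the given one.

    The functions [x + i y] and [2 x y - 4 z + i (x ^ 2 + y ^ 2)] are
    annihilated by [L].  They are the coordinates of a diffeomorphism of the
    group onto the quadric that is a homomorphism for the displayed product
    ([quadric_mapM]), and the line of [L] is exactly what the condition to be of
    type (0,1) leaves of the complexified tangent space
    ([CR_equivalence_quadric]).

    The Cayley transform is a biholomorphism between open sets of the plane that
    contain the quadric and the sphere without the point (1, 0), and it exchanges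
    the two; a biholomorphism respects the induced structures
    ([induced_CR_equivalence], [CR_equivalence_cayley]).

    The analytic input is that smooth maps are stable under composition and that
    the differential on a submanifold, defined through an arbitrary local
    extension, satisfies the chain rule on tangent vectors ([class_C_comp],
    [differentialE], [differential_comp]).  Brackets of vector fields on a
    submanifold are likewise independent of the extensions, and smooth
    ([smooth_bracket]). *)

(** * Functions of class C^n on open sets *)

Section ClassC.
Variable R : realType.
Implicit Types E F G : normedModType R.

Lemma near_open E (U : set E) x : open U -> U x -> \forall y \near x, U y.
Proof. by move=> oU Ux; exact: open_nbhs_nbhs. Qed.

Lemma near_eq_differentiable E F (f g : E -> F) a :
  (\forall x \near a, f x = g x) -> differentiable f a ->
  differentiable g a /\ 'd g a = 'd f a :> (E -> F).
Proof.
move=> fg df; have [dc fo] := (diff_locallyP a f).1 df.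
have fga : f a = g a by exact: nbhs_singleton fg.
have go : g \o shift a = cst (g a) + 'd f a +o_ 0 id.
  apply/eqaddoP => e e0; move/eqaddoP : fo => /(_ e e0); apply: filter_app.
  have := fg; rewrite (near_shift 0) subr0 => fg0.
  near=> h; have fgh : f (h + a) = g (h + a) by near: h; exact: fg0.
  by rewrite /= /cst !fctE /= fgh fga.
have dg := diff_unique dc go; split; last exact: dg.
by apply/diff_locallyP; rewrite dg; split.
Unshelve. all: by end_near.
Qed.

Lemma differentiable_scale E F (k : E -> R^o) (f : E -> F) a :
  differentiable k a -> differentiable f a ->
  differentiable (fun x => k x *: f x) a /\
  'd (fun x => k x *: f x) a =
    (fun v => k a *: 'd f a v + 'd k a v *: f a) :> (E -> F).
Proof.
move=> dk df.
have bil : bilinear_for (GRing.Scale.Law.clone _ _ *:%R _)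
    (GRing.Scale.Law.clone _ _ *:%R _) (@GRing.scale R F : R^o -> F -> F).
  split=> [u'|u] b x y /=; first by rewrite scalerDl scalerA.
  by rewrite scalerDr !scalerA mulrC.
pose B : {bilinear R^o -> F -> F} := HB.pack (@GRing.scale R F)
  (bilinear_isBilinear.Build R R^o F F _ _ _ bil).
have Bc : continuous (fun p : R^o * F => B p.1 p.2).
  by move=> p; exact: scale_continuous.
pose h x := (k x, f x).
have dh : differentiable h a by exact: differentiable_pair.
have dB := differentiable_bilin (h a) Bc.
have hE : (fun x => k x *: f x) = (fun p : R^o * F => B p.1 p.2) \o h by [].
rewrite hE; split; first exact: differentiable_comp.
by rewrite diff_comp // diff_bilin // /h diff_pair.
Qed.

(** Smoothness asks for differentiability of the iterates along lists of
    directions, which have no convenient induction.  The recursion on the order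
    below peels off the derivative that is taken first, so that a rule for one
    derivative propagates to all orders. *)
Fixpoint class_C n E F (U : set E) (f : E -> F) : Prop :=
  (forall x, U x -> differentiable f x) /\
  if n is m.+1 then forall v, class_C m U ('D_v f) else True.

Lemma smoothP E F (U : set E) (f : E -> F) :
  smooth U f <-> open U /\ forall n, class_C n U f.
Proof.
split=> -[oU Hf]; split=> //.
  move=> n; elim: n f Hf => [|n IH] f Hf.
    by split=> // x; exact: (Hf [::]).
  split=> [x|v]; first exact: (Hf [::]).
  by apply: IH => vs x Ux; rewrite -foldr_rcons; exact: Hf.
move=> vs; elim/last_ind: vs f Hf => [|vs v IH] f Hf x Ux.
  by case: (Hf 0) => df _; exact: df.
by rewrite foldr_rcons; apply: IH => // n; case: (Hf n.+1) => _; exact.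
Qed.

Lemma class_C_diff n E F (U : set E) (f : E -> F) x :
  class_C n U f -> U x -> differentiable f x.
Proof. by case: n => [|n] [df _]; exact: df. Qed.

Lemma class_C_le n E F (U : set E) (f : E -> F) :
  class_C n.+1 U f -> class_C n U f.
Proof.
elim: n f => [|n IH] f [df Df]; first by split.
by split=> // v; exact: IH.
Qed.

Lemma class_C_eq n E F (U : set E) (f g : E -> F) :
  open U -> (forall x, U x -> f x = g x) -> class_C n U f -> class_C n U g.
Proof.
move=> oU; have near_fg (f' g' : E -> F) (x : E) : U x ->
    (forall y, U y -> f' y = g' y) -> \forall y \near x, f' y = g' y.
  by move=> Ux fg; near=> y; apply: fg; near: y; exact: near_open.
elim: n f g => [|n IH] f g fg [df Df].
  split=> // x Ux.
  exact: (near_eq_differentiable (near_fg _ _ _ Ux fg) (df x Ux)).1.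
split=> [x Ux|v].
  exact: (near_eq_differentiable (near_fg _ _ _ Ux fg) (df x Ux)).1.
by apply: IH (Df v) => x Ux; apply: near_eq_derive; exact: near_fg.
Unshelve. all: by end_near.
Qed.

Lemma class_C_cst n E F (U : set E) (a : F) : class_C n U (fun=> a).
Proof.
elim: n a => [|n IH] a; split=> //;
  try by move=> x _; exact: differentiable_cst.
move=> v; have -> : 'D_v (fun=> a) = (fun=> 0) :> (E -> F); last exact: IH.
by apply/funext => x; exact: derive_cst.
Qed.

Lemma class_C_linear n E F (U : set E) (f : {linear E -> F}) :
  continuous f -> class_C n U f.
Proof.
move=> fc; case: n => [|n]; split=> //;
  try by move=> x _; exact: linear_differentiable.
move=> v; have -> : 'D_v f = (fun=> f v); last exact: class_C_cst.
apply/funext => x.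
by rewrite (deriveE v (linear_differentiable x fc)) (diff_lin _ fc).
Qed.

Lemma class_CD n E F (U : set E) (f g : E -> F) : open U ->
  class_C n U f -> class_C n U g -> class_C n U (fun x => f x + g x).
Proof.
move=> oU; elim: n f g => [|n IH] f g [df Df] [dg Dg].
  by split=> // x Ux; exact: differentiableD (df _ Ux) (dg _ Ux).
split=> [x Ux|v]; first exact: differentiableD (df _ Ux) (dg _ Ux).
apply: class_C_eq (IH _ _ (Df v) (Dg v)) => // x Ux.
have dfv := diff_derivable (v := v) (df x Ux).
have dgv := diff_derivable (v := v) (dg x Ux).
by rewrite -(deriveD dfv dgv).
Qed.

Lemma class_C_sum n E F (U : set E) m (f : 'I_m -> E -> F) : open U ->
  (forall i, class_C n U (f i)) -> class_C n U (fun x => \sum_i f i x).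
Proof.
move=> oU; elim: m f => [|m IH] f Hf.
  by under eq_fun do rewrite big_ord0; exact: class_C_cst.
under eq_fun do rewrite big_ord_recr /=.
by apply: class_CD => //; exact: IH.
Qed.

Lemma class_C_scale n E F (U : set E) (k : E -> R^o) (f : E -> F) : open U ->
  class_C n U k -> class_C n U f -> class_C n U (fun x => k x *: f x).
Proof.
move=> oU; elim: n k f => [|n IH] k f Ck Cf.
  split=> // x Ux; apply: (differentiable_scale _ _).1;
  [exact: class_C_diff Ck Ux|exact: class_C_diff Cf Ux].
have dk x Ux : differentiable k x := class_C_diff Ck Ux.
have df x Ux : differentiable f x := class_C_diff Cf Ux.
split=> [x Ux|v].
  by apply: (differentiable_scale _ _).1; [exact: dk|exact: df].
have [_ Dk] := Ck; have [_ Df] := Cf.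
have C1 := IH _ _ (class_C_le Ck) (Df v).
have C2 := IH _ _ (Dk v) (class_C_le Cf).
apply: class_C_eq (class_CD oU C1 C2) => // x Ux.
have [dkf dkfE] := differentiable_scale (dk x Ux) (df x Ux).
by rewrite (deriveE v dkf) dkfE (deriveE v (df x Ux)) (deriveE v (dk x Ux)).
Qed.

(** The derivative [- k^-1 * (k^-1 * 'D_v k)] of the inverse involves the
    inverse only to the preceding order, so the product rule suffices. *)
Lemma class_C_inv n E (U : set E) (k : E -> R^o) : open U ->
  (forall x, U x -> k x != 0) -> class_C n U k ->
  class_C n U (fun x => (k x)^-1 : R^o).
Proof.
move=> oU k0; elim: n => [|n IH] Ck.
  split=> // x Ux; apply: differentiableV (k0 _ Ux).
  exact: class_C_diff Ck Ux.
have dk x Ux : differentiable k x := class_C_diff Ck Ux.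
split=> [x Ux|v]; first by apply: differentiableV (k0 _ Ux); exact: dk.
have Ci := IH (class_C_le Ck); have [_ Dk] := Ck.
have C2 := class_C_scale oU (class_C_cst n U (- 1 : R^o))
  (class_C_scale oU Ci (class_C_scale oU Ci (Dk v))).
apply: class_C_eq C2 => // x Ux.
have dki := differentiableV (dk x Ux) (k0 x Ux).
have dkiE := congr1 (fun h => h v) (diffV (dk x Ux) (k0 x Ux)).
rewrite (deriveE v dki) (deriveE v (dk x Ux)) [RHS]dkiE.
rewrite -[RHS]/(- (k x) ^- 2 *: 'd k x v).
by rewrite -exprVn expr2 scaleN1r scalerA scaleNr.
Qed.

Lemma class_C_pair n E F G (U : set E) (f : E -> F) (g : E -> G) : open U ->
  class_C n U f -> class_C n U g -> class_C n U (fun x => (f x, g x)).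
Proof.
move=> oU; elim: n f g => [|n IH] f g Cf Cg.
  split=> // x Ux.
  exact: differentiable_pair (class_C_diff Cf Ux) (class_C_diff Cg Ux).
have df x Ux : differentiable f x := class_C_diff Cf Ux.
have dg x Ux : differentiable g x := class_C_diff Cg Ux.
split=> [x Ux|v]; first exact: differentiable_pair (df x Ux) (dg x Ux).
have [_ Df] := Cf; have [_ Dg] := Cg.
apply: class_C_eq (IH _ _ (Df v) (Dg v)) => // x Ux.
rewrite (deriveE v (differentiable_pair (df x Ux) (dg x Ux))).
rewrite (deriveE v (df x Ux)) (deriveE v (dg x Ux)).
by rewrite (diff_pair (df x Ux) (dg x Ux)).
Qed.

(** Coordinates on [E].  They serve to write the differential as a finite sum
    of directional derivatives, so that its smoothness at every order can be
    read off from theirs. *)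
Definition finite_dim E : Prop :=
  exists n (e : 'I_n -> E) (c : 'I_n -> {linear E -> R^o}),
    (forall i, continuous (c i)) /\ forall x, x = \sum_i c i x *: e i.

Lemma finite_dim_continuous E F (f : {linear E -> F}) :
  finite_dim E -> continuous f.
Proof.
move=> [n [e [c [cc ce]]]].
have -> : (f : E -> F) = fun x => \sum_(i < n) c i x *: f (e i).
  apply/funext => x; rewrite {1}[x]ce linear_sum; apply: eq_bigr => i _.
  by rewrite linearZ.
move=> x; apply: differentiable_continuous.
apply: (@class_C_diff 0 _ _ setT) => //; apply: class_C_sum openT _ => i.
apply: class_C_scale openT _ _; last exact: class_C_cst.
exact: class_C_linear.
Qed.

Lemma class_C_linear_comp n E F G (U : set E) (f : {linear F -> G})
    (g : E -> F) :
  open U -> continuous f -> class_C n U g -> class_C n U (f \o g).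
Proof.
move=> oU fc; elim: n g => [|n IH] g Cg.
  split=> // x Ux; apply: differentiable_comp (class_C_diff Cg Ux) _.
  exact: linear_differentiable.
have dg x Ux : differentiable g x := class_C_diff Cg Ux.
have dfg x (Ux : U x) : differentiable (f \o g) x.
  exact: differentiable_comp (dg x Ux) (linear_differentiable (g x) fc).
split=> // v; have [_ /(_ v) /IH] := Cg.
apply: class_C_eq => // x Ux; have df := linear_differentiable (g x) fc.
rewrite /= (deriveE v (dfg x Ux)) (deriveE v (dg x Ux)).
by rewrite (diff_comp (dg x Ux) df) (diff_lin _ fc).
Qed.

(** In coordinates [c_i] dual to [e_i] the chain rule reads
    ['D_v (f \o g) = \sum_i c_i ('D_v g) *: ('D_(e_i) f \o g)], in which [f] and
    [g] enter through derivatives or at the preceding order. *)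
Lemma class_C_comp n E F G (U : set E) (V : set F) (f : F -> G) (g : E -> F) :
  finite_dim F -> open U -> open V -> (forall x, U x -> V (g x)) ->
  class_C n V f -> class_C n U g -> class_C n U (f \o g).
Proof.
move=> [m [e [c [cc ce]]]] oU oV gUV.
elim: n f g gUV => [|n IH] f g gUV Cf Cg.
  split=> // x Ux; apply: differentiable_comp (class_C_diff Cg Ux) _.
  exact: class_C_diff Cf (gUV _ Ux).
have dg x Ux : differentiable g x := class_C_diff Cg Ux.
have df x Vx : differentiable f x := class_C_diff Cf Vx.
have dfg x (Ux : U x) : differentiable (f \o g) x.
  exact: differentiable_comp (dg x Ux) (df _ (gUV _ Ux)).
split=> // v; have [_ Df] := Cf; have [_ Dg] := Cg.
have Ci i : class_C n U (fun x => c i ('D_v g x) *: 'D_(e i) f (g x)).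
  apply: (@class_C_scale n E G U (c i \o 'D_v g) ('D_(e i) f \o g)) => //.
    exact: class_C_linear_comp oU (cc i) (Dg v).
  exact: IH gUV (Df (e i)) (class_C_le Cg).
apply: class_C_eq (class_C_sum oU Ci) => // x Ux.
have dfgx := df _ (gUV _ Ux).
rewrite (deriveE v (dfg x Ux)) (diff_comp (dg x Ux) dfgx) /=.
under eq_bigr => i _ do
  rewrite (deriveE v (dg x Ux)) (deriveE (e i) dfgx).
rewrite [in RHS](ce ('d g x v)) linear_sum; apply: eq_bigr => i _.
by rewrite linearZ.
Qed.

End ClassC.

(** * Smooth maps on open sets *)

Section SmoothMaps.
Variable R : realType.
Implicit Types E F G : normedModType R.

Lemma smooth_differentiable E F (U : set E) (f : E -> F) x :
  smooth U f -> U x -> differentiable f x.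
Proof. by move=> [_ /(_ [::]) df] /df. Qed.

Lemma smooth_open E F (U : set E) (f : E -> F) : smooth U f -> open U.
Proof. by case. Qed.

Lemma smooth_linear E F (U : set E) (f : {linear E -> F}) :
  finite_dim E -> open U -> smooth U f.
Proof.
move=> fdE oU; apply/smoothP; split=> // n; apply: class_C_linear.
exact: finite_dim_continuous.
Qed.

Lemma smooth_cst E F (U : set E) (a : F) : open U -> smooth U (fun=> a).
Proof. by move=> oU; apply/smoothP; split=> // n; exact: class_C_cst. Qed.

Lemma smoothD E F (U : set E) (f g : E -> F) :
  smooth U f -> smooth U g -> smooth U (fun x => f x + g x).
Proof.
move=> /smoothP[oU Cf] /smoothP[_ Cg]; apply/smoothP; split=> // n.
exact: class_CD.
Qed.

Lemma smooth_sum E F (U : set E) m (f : 'I_m -> E -> F) : open U ->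
  (forall i, smooth U (f i)) -> smooth U (fun x => \sum_i f i x).
Proof.
move=> oU Hf; apply/smoothP; split=> // n; apply: class_C_sum => // i.
by have /smoothP[] := Hf i.
Qed.

Lemma smooth_scale E F (U : set E) (k : E -> R^o) (f : E -> F) :
  smooth U k -> smooth U f -> smooth U (fun x => k x *: f x).
Proof.
move=> /smoothP[oU Ck] /smoothP[_ Cf]; apply/smoothP; split=> // n.
exact: class_C_scale.
Qed.

Lemma smooth_inv E (U : set E) (k : E -> R^o) :
  smooth U k -> (forall x, U x -> k x != 0) ->
  smooth U (fun x => (k x)^-1 : R^o).
Proof.
move=> /smoothP[oU Ck] k0; apply/smoothP; split=> // n.
exact: class_C_inv.
Qed.

Lemma smooth_pair E F G (U : set E) (f : E -> F) (g : E -> G) :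
  smooth U f -> smooth U g -> smooth U (fun x => (f x, g x)).
Proof.
move=> /smoothP[oU Cf] /smoothP[_ Cg]; apply/smoothP; split=> // n.
exact: class_C_pair.
Qed.

Lemma smooth_derive E F (U : set E) (f : E -> F) v :
  smooth U f -> smooth U ('D_v f).
Proof.
move=> /smoothP[oU Cf]; apply/smoothP; split=> // n.
by have [_] := Cf n.+1; exact.
Qed.

Lemma smooth_subset E F (U U' : set E) (f : E -> F) :
  open U' -> U' `<=` U -> smooth U f -> smooth U' f.
Proof. by move=> oU' sU [_ df]; split=> // vs x /sU; exact: df. Qed.

Lemma smooth_eq E F (U : set E) (f g : E -> F) :
  (forall x, U x -> f x = g x) -> smooth U f -> smooth U g.
Proof.
move=> fg /smoothP[oU Cf]; apply/smoothP; split=> // n.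
exact: class_C_eq (Cf n).
Qed.

Lemma smoothB E F (U : set E) (f g : E -> F) :
  smooth U f -> smooth U g -> smooth U (fun x => f x - g x).
Proof.
move=> sf sg; have oU := smooth_open sf.
have sN := smooth_scale (smooth_cst (-1 : R^o) oU) sg.
by apply: smooth_eq (smoothD sf sN) => x _; rewrite scaleN1r.
Qed.

Lemma open_smooth_preimage E F (U : set E) (V : set F) (g : E -> F) :
  smooth U g -> open V -> open (U `&` g @^-1` V).
Proof.
move=> sg oV; rewrite openE => x [Ux Vgx].
apply: filterI; first exact: near_open (smooth_open sg) Ux.
have /differentiable_continuous := smooth_differentiable sg Ux.
by apply; exact: open_nbhs_nbhs.
Qed.

Lemma smooth_comp E F G (U : set E) (V : set F) (f : F -> G) (g : E -> F) :
  finite_dim F -> smooth V f -> smooth U g ->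
  smooth (U `&` g @^-1` V) (f \o g).
Proof.
move=> fdF /smoothP[oV Cf] sg.
have oUV := open_smooth_preimage sg oV.
have /smoothP[_ Cg] : smooth (U `&` g @^-1` V) g.
  by apply: smooth_subset sg => // x [].
apply/smoothP; split=> // n.
by apply: class_C_comp fdF oUV oV _ (Cf n) (Cg n) => x [].
Qed.

Lemma smooth_comp_linear E F G (U : set E) (f : {linear F -> G}) (g : E -> F) :
  finite_dim F -> smooth U g -> smooth U (f \o g).
Proof.
move=> fdF sg; have := smooth_comp fdF (smooth_linear f fdF openT) sg.
by rewrite preimage_setT setIT.
Qed.

Lemma smooth_diff E F (U : set E) (f : E -> F) (u : E -> E) :
  finite_dim E -> smooth U f -> smooth U u ->
  smooth U (fun x => 'd f x (u x)).
Proof.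
move=> fdE sf su; have [n [e [c [cc ce]]]] := fdE; have oU := smooth_open sf.
apply: (@smooth_eq _ _ _ (fun x => \sum_i c i (u x) *: 'D_(e i) f x)).
  move=> x Ux; rewrite [in RHS](ce (u x)) linear_sum; apply: eq_bigr => i _.
  by rewrite linearZ (deriveE _ (smooth_differentiable sf Ux)).
apply: smooth_sum => // i; apply: smooth_scale; last exact: smooth_derive.
exact: (smooth_comp_linear (c i) fdE su).
Qed.

Definition fstL E F : {linear (E * F)%type -> E} :=
  HB.pack (@fst E F)
    (GRing.isLinear.Build _ _ _ _ (@fst E F) (fun _ _ _ => erefl)).

Definition sndL E F : {linear (E * F)%type -> F} :=
  HB.pack (@snd E F)
    (GRing.isLinear.Build _ _ _ _ (@snd E F) (fun _ _ _ => erefl)).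

Lemma entry_linear m n (i : 'I_m) (j : 'I_n) :
  linear (fun M : 'M[R]_(m, n) => M i j : R^o).
Proof. by move=> k u v; rewrite !mxE. Qed.

Definition entry m n (i : 'I_m) (j : 'I_n) : {linear 'M[R]_(m, n) -> R^o} :=
  HB.pack (fun M : 'M[R]_(m, n) => M i j : R^o)
    (GRing.isLinear.Build _ _ _ _ _ (entry_linear i j)).

Lemma finite_dim_fin E (I : finType) (e : I -> E) (c : I -> {linear E -> R^o}) :
  (forall i, continuous (c i)) -> (forall x, x = \sum_i c i x *: e i) ->
  finite_dim E.
Proof.
move=> cc ce; exists #|I|, (e \o enum_val), (c \o enum_val).
split=> [i|x]; first exact: cc.
rewrite {1}[x]ce (reindex (@enum_val _ I)) //.
by apply: onW_bij; exact: enum_val_bij.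
Qed.

Lemma finite_dim_R : finite_dim (R^o : normedModType R).
Proof.
exists 1%N, (fun=> 1 : R^o), (fun=> idfun).
split=> [i x|x]; first exact: cvg_id.
by rewrite big_ord1 /= [RHS]mulr1.
Qed.

Lemma finite_dim_mx m n : finite_dim ('M[R]_(m, n) : normedModType R).
Proof.
apply: (@finite_dim_fin _ ('I_m * 'I_n)%type (fun p => delta_mx p.1 p.2)
  (fun p => entry p.1 p.2)) => [p|M]; first exact: coord_continuous.
by rewrite {1}[M]matrix_sum_delta pair_bigA.
Qed.

Lemma finite_dim_prod E F : finite_dim E -> finite_dim F ->
  finite_dim ((E * F)%type : normedModType R).
Proof.
move=> [n [e [c [cc ce]]]] [m [e' [c' [cc' ce']]]].
pose b (i : 'I_n + 'I_m) : E * F :=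
  match i with inl i => (e i, 0) | inr j => (0, e' j) end.
pose d (i : 'I_n + 'I_m) : {linear (E * F)%type -> R^o} :=
  match i with
  | inl i => (c i \o fstL E F)%R
  | inr j => (c' j \o sndL E F)%R
  end.
apply: (@finite_dim_fin _ ('I_n + 'I_m)%type b d).
  case=> i x; apply: continuous_comp;
  [exact: cvg_fst|exact: cc|exact: cvg_snd|exact: cc'].
move=> [x y]; rewrite big_sumType /=.
have -> : \sum_(i < n) c i x *: ((e i, 0) : E * F) = (x, 0).
  rewrite {2}[x]ce; elim/big_rec2: _ => // i u v _ ->.
  by congr pair; rewrite /= ?scaler0 ?addr0.
have -> : \sum_(i < m) c' i y *: ((0, e' i) : E * F) = (0, y).
  rewrite {2}[y]ce'; elim/big_rec2: _ => // i u v _ ->.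
  by congr pair; rewrite /= ?scaler0 ?addr0.
by congr pair; rewrite /= ?addr0 ?add0r.
Qed.

End SmoothMaps.

(** * Tangent vectors and differentials *)

Section Differentials.
Variable R : realType.
Implicit Types E F G : normedModType R.

(** The chosen extension is irrelevant on tangent vectors: along a curve in [A],
    two extensions of [f] agree, hence have the same derivative. *)
Lemma differentialE E F (A U : set E) (f g : E -> F) p v :
  A p -> U p -> smooth U g -> (forall x, A x -> U x -> g x = f x) ->
  tangent A p v -> differential A f p v = 'd g p v.
Proof.
move=> Ap Up sg gf [I [gam [I0 sgam gamA gam0 <-]]]; rewrite /differential.
have : local_extension A f p !=set0 by exists g, U.
case: xgetP => [h _ [W [Wp sh hf]] _|nog]; last first.
  by case=> h Hh; case: (nog h Hh).
have dgam := smooth_differentiable sgam I0.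
have dh : differentiable h (gam 0).
  by rewrite gam0; exact: smooth_differentiable sh Wp.
have dg : differentiable g (gam 0).
  by rewrite gam0; exact: smooth_differentiable sg Up.
have ghgam : \forall t \near 0, (g \o gam) t = (h \o gam) t.
  have cgam := differentiable_continuous dgam.
  have nU : \forall t \near 0, U (gam t).
    by apply: cgam; rewrite gam0; exact: near_open (smooth_open sg) Up.
  have nW : \forall t \near 0, W (gam t).
    by apply: cgam; rewrite gam0; exact: near_open (smooth_open sh) Wp.
  have nI := near_open (smooth_open sgam) I0.
  near=> t; have It : I t by near: t.
  by rewrite /= gf ?hf //; [exact: gamA|near: t|exact: gamA|near: t].
have [_ e] := near_eq_differentiable ghgam (differentiable_comp dgam dg).
have /(congr1 (fun k => k 1)) := e.
by rewrite [in RHS](diff_comp dgam dg) [in LHS](diff_comp dgam dh) /= gam0.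
Unshelve. all: by end_near.
Qed.

Lemma differential_smooth E F (A U : set E) (f : E -> F) p v :
  A p -> U p -> smooth U f -> tangent A p v -> differential A f p v = 'd f p v.
Proof. by move=> Ap Up sf tv; exact: differentialE Ap Up sf _ tv. Qed.

Lemma eq_differential E F (A : set E) (f g : E -> F) p v :
  smooth_map A g -> (forall x, A x -> f x = g x) -> A p -> tangent A p v ->
  differential A f p v = differential A g p v.
Proof.
move=> sg fg Ap tv; have [g' [U [Up sg' gg]]] := sg _ Ap.
rewrite (differentialE Ap Up sg' gg tv) (differentialE Ap Up sg' _ tv) //.
by move=> x Ax Ux; rewrite fg // gg.
Qed.

Lemma smooth_smooth_map E F (A U : set E) (f : E -> F) :
  A `<=` U -> smooth U f -> smooth_map A f.
Proof. by move=> AU sf p Ap; exists f, U; split=> //; exact: AU. Qed.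

Lemma smooth_map_comp E F G (A : set E) (B : set F) (f : E -> F) (g : F -> G) :
  finite_dim F -> smooth_map A f -> (forall x, A x -> B (f x)) ->
  smooth_map B g -> smooth_map A (g \o f).
Proof.
move=> fdF sf fAB sg p Ap; have [f' [U [Up sf' ff]]] := sf _ Ap.
have [g' [V [Vp sg' gg]]] := sg _ (fAB _ Ap).
exists (g' \o f'), (U `&` f' @^-1` V); split.
- by split=> //=; rewrite ff.
- exact: smooth_comp fdF sg' sf'.
- move=> x Ax [Ux Vx]; rewrite /= in Vx *; rewrite ff // in Vx *.
  by rewrite gg //; exact: fAB.
Qed.

Lemma tangent_line E (A : set E) (I : set R^o) p v : open I -> I 0 ->
  (forall t, I t -> A (p + (t : R) *: v)) -> tangent A p v.
Proof.
move=> oI I0 IA; exists I, (fun t : R^o => p + (t : R) *: v).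
have sid := smooth_linear (idfun : {linear R^o -> R^o}) (finite_dim_R R).
split=> //.
- exact: smoothD (smooth_cst p oI) (smooth_scale (sid _ oI) (smooth_cst v oI)).
- by rewrite scale0r addr0.
have dt : differentiable (id : R^o -> R^o) 0.
  exact: smooth_differentiable (sid _ oI) I0.
have dtv := differentiableZl v dt.
have lineE := congr1 (fun h => h 1) (diffD (differentiable_cst p 0) dtv).
rewrite [LHS]lineE.
rewrite /= (diff_cst p (0 : R^o)) (diffZl v dt) add0r.
by rewrite (@diff_lin _ _ _ idfun) ?scale1r // => x; exact: cvg_id.
Qed.

Lemma tangent_differential E F (A : set E) (B : set F) (f : E -> F) p v :
  finite_dim E -> smooth_map A f -> (forall x, A x -> B (f x)) -> A p ->
  tangent A p v -> tangent B (f p) (differential A f p v).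
Proof.
move=> fdE sf fAB Ap tv; have [g [U [Up sg gf]]] := sf _ Ap.
rewrite (differentialE Ap Up sg gf tv).
move: tv => [I [gam [I0 sgam gamA gam0 <-]]].
exists (I `&` gam @^-1` U), (g \o gam); split.
- by split=> //=; rewrite gam0.
- exact: smooth_comp fdE sg sgam.
- by move=> t [It Ut]; rewrite /= gf //; [apply: fAB|]; exact: gamA.
- by rewrite /= gam0 gf.
- have dg : differentiable g (gam 0).
    by rewrite gam0; exact: smooth_differentiable sg Up.
  by rewrite (diff_comp (smooth_differentiable sgam I0) dg) /= gam0.
Qed.

Lemma differential_comp E F G (A : set E) (B : set F) (f : E -> F) (g : F -> G)
    p v :
  finite_dim E -> finite_dim F ->
  smooth_map A f -> (forall x, A x -> B (f x)) -> smooth_map B g ->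
  A p -> tangent A p v ->
  differential A (g \o f) p v = differential B g (f p) (differential A f p v).
Proof.
move=> fdE fdF sf fAB sg Ap tv; have [f' [U [Up sf' ff]]] := sf _ Ap.
have [g' [V [Vp sg' gg]]] := sg _ (fAB _ Ap).
have tv' := tangent_differential fdE sf fAB Ap tv.
have f'p : f' p = f p by exact: ff.
have sgf := smooth_comp fdF sg' sf'.
have df := smooth_differentiable sf' Up.
have dg : differentiable g' (f' p).
  by rewrite f'p; exact: smooth_differentiable sg' Vp.
rewrite (differentialE (fAB _ Ap) Vp sg' gg tv') (differentialE Ap Up sf' ff tv).
rewrite (@differentialE _ _ _ _ _ _ _ _ Ap _ sgf) //.
- by rewrite (diff_comp df dg) /= f'p.
- by split=> //=; rewrite f'p.
- move=> x Ax [Ux Vx]; rewrite /= in Vx *; rewrite ff // in Vx *.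
  by rewrite gg //; exact: fAB.
Qed.

Lemma differential_id E (A : set E) p v :
  finite_dim E -> A p -> tangent A p v -> differential A id p v = v.
Proof.
move=> fdE Ap tv; have sid := smooth_linear (idfun : {linear E -> E}) fdE openT.
rewrite (differential_smooth Ap Logic.I sid tv).
by rewrite (@diff_lin _ _ _ idfun) // => x; exact: cvg_id.
Qed.

Lemma diffeomorphism_tangent_onto E F (A : set E) (B : set F) (f : E -> F) p w :
  finite_dim E -> finite_dim F -> diffeomorphism A B f -> A p ->
  tangent B (f p) w -> exists2 v, tangent A p v & differential A f p v = w.
Proof.
move=> fdE fdF [sf fAB [g [sg gBA gf fg]]] Ap tw.
have tv := tangent_differential fdF sg gBA (fAB _ Ap) tw.
have fgw := differential_comp fdF fdE sg gBA sf (fAB _ Ap) tw.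
rewrite gf // in tv fgw; exists (differential B g (f p) w) => //.
rewrite -fgw (@eq_differential _ _ _ _ id) ?differential_id //; try exact: fAB.
exact: smooth_smooth_map (smooth_linear (U := setT) idfun fdF openT).
Qed.

Lemma diffeomorphism_comp E F G (A : set E) (B : set F) (C : set G)
    (f : E -> F) (g : F -> G) :
  finite_dim F -> diffeomorphism A B f -> diffeomorphism B C g ->
  diffeomorphism A C (g \o f).
Proof.
move=> fdF [sf fAB [f' [sf' fBA ff' f'f]]] [sg gBC [g' [sg' gCB gg' g'g]]].
split; first exact: smooth_map_comp fdF sf fAB sg.
  by move=> x /fAB /gBC.
exists (f' \o g'); split; first exact: smooth_map_comp fdF sg' gCB sf'.
- by move=> x /gCB /fBA.
- by move=> x Ax; rewrite /= gg' ?ff' //; exact: fAB.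
- by move=> x Cx; rewrite /= f'f ?g'g //; exact: gCB.
Qed.

Lemma differential_kernel E F G (A : set E) (f : E -> F) (l : {linear F -> G})
    p v :
  finite_dim F -> smooth_map A f -> (forall x, A x -> l (f x) = 0) ->
  A p -> tangent A p v -> l (differential A f p v) = 0.
Proof.
move=> fdF sf lf Ap tv; have [f' [U [Up sf' ff]]] := sf _ Ap.
have lc := finite_dim_continuous (f := l) fdF.
have df := smooth_differentiable sf' Up.
have dl := linear_differentiable (f' p) lc.
rewrite (differentialE Ap Up sf' ff tv).
(* [l \o f'] is a local extension of the zero function on [A] *)
have := differentialE (f := cst 0) Ap Up (smooth_comp_linear l fdF sf') _ tv.
rewrite (diff_comp df dl) (diff_lin _ lc) /= => <-; last first.
  by move=> x Ax Ux; rewrite /= ff // lf.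
rewrite (differentialE (f := cst 0) Ap I (smooth_cst 0 openT) _ tv) //.
by rewrite diff_cst.
Qed.

End Differentials.

(** * CR equivalences and brackets *)

Section CRGeneralities.
Variable R : realType.
Implicit Types E F G : normedModType R.

Lemma CR_equivalence_comp E F G (A : set E) (B : set F) (C : set G)
    (V : E -> set (E * E)) (W : F -> set (F * F)) (X : G -> set (G * G))
    (f : E -> F) (g : F -> G) :
  finite_dim E -> finite_dim F -> (forall p, A p -> V p `<=` ctangent A p) ->
  CR_equivalence A V B W f -> CR_equivalence B W C X g ->
  CR_equivalence A V C X (g \o f).
Proof.
move=> fdE fdF VA [df fV] [dg gW]; split; first exact: diffeomorphism_comp dg.
have [sf fAB _] := df; have [sg _ _] := dg.
move=> p Ap; rewrite /= -gW; last exact: fAB.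
rewrite -fV // image_comp; apply: eq_imagel => w /(VA _ Ap) [t1 t2].
by rewrite /= /cdifferential !(differential_comp fdE fdF sf fAB sg).
Qed.

Lemma CR_equivalence_eq E F (M : set E) (N : set F) V V' W W' (f : E -> F) :
  (forall p, M p -> V p = V' p) -> (forall q, N q -> W q = W' q) ->
  CR_equivalence M V N W f -> CR_equivalence M V' N W' f.
Proof.
move=> VV WW [df fV]; split=> // p Mp; have [_ fMN _] := df.
by rewrite -VV // -WW ?fV //; exact: fMN.
Qed.

Lemma cdifferential_scale E F (A : set E) (f : E -> F) p k w :
  cdifferential A f p (cplx_scale k w) = cplx_scale k (cdifferential A f p w).
Proof.
by rewrite /cdifferential /cplx_scale /differential /= linearB linearD !linearZ.
Qed.

Lemma cplx_scale_linear E (c : R[i]) : linear (@cplx_scale R E c).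
Proof.
move=> a [u1 u2] [v1 v2].
congr pair; rewrite /= !scalerDr ?scalerN !scalerA !(mulrC a).
  by rewrite opprD addrACA.
by rewrite addrACA.
Qed.

Definition cplx_scaleL E (c : R[i]) : {linear (E * E)%type -> (E * E)%type} :=
  HB.pack (@cplx_scale R E c)
    (GRing.isLinear.Build _ _ _ _ _ (@cplx_scale_linear E c)).

Definition cdiff E F (X : E -> F * F) p (w : E * E) : F * F :=
  'd X p w.1 + cplx_scale 'i ('d X p w.2).

Lemma smooth_cdiff E (U : set E) (X Y : E -> E * E) : finite_dim E ->
  smooth U X -> smooth U Y -> smooth U (fun q => cdiff Y q (X q)).
Proof.
move=> fdE sX sY; have fdEE := finite_dim_prod fdE fdE.
have sX1 := smooth_comp_linear (fstL E E) fdEE sX.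
have sX2 := smooth_comp_linear (sndL E E) fdEE sX.
apply: smoothD; first exact: smooth_diff fdE sY sX1.
by apply: (smooth_comp_linear (cplx_scaleL E 'i) fdEE); exact: smooth_diff.
Qed.

(** The bracket evaluates differentials of maps defined on [A] only.  When the
    fields are tangent to [A], any local extensions compute it, which makes it
    smooth. *)
Lemma smooth_bracket E (A : set E) (X Y : E -> E * E) : finite_dim E ->
  (forall q, A q -> ctangent A q (X q)) ->
  (forall q, A q -> ctangent A q (Y q)) ->
  smooth_map A X -> smooth_map A Y -> smooth_map A (bracket A X Y).
Proof.
move=> fdE tX tY sX sY p Ap.
have [X' [U [Up sX' XX]]] := sX _ Ap.
have [Y' [V [Vp sY' YY]]] := sY _ Ap.
exists (fun q => cdiff Y' q (X' q) - cdiff X' q (Y' q)), (U `&` V).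
have oUV : open (U `&` V) := openI (smooth_open sX') (smooth_open sY').
have sX2 : smooth (U `&` V) X' by apply: smooth_subset sX' => // x [].
have sY2 : smooth (U `&` V) Y' by apply: smooth_subset sY' => // x [].
split=> //; first by apply: smoothB; exact: smooth_cdiff.
move=> q Aq [Uq Vq].
rewrite /bracket /cderivative /cdiff (XX q Aq Uq) (YY q Aq Vq).
have [tX1 tX2] := tX _ Aq; have [tY1 tY2] := tY _ Aq.
rewrite (differentialE Aq Vq sY' YY tX1) (differentialE Aq Vq sY' YY tX2).
by rewrite (differentialE Aq Uq sX' XX tY1) (differentialE Aq Uq sX' XX tY2).
Qed.

Lemma kernel_comb E (l : {linear E -> R^o}) a b u v :
  l u = 0 -> l v = 0 -> l (a *: u + b *: v) = 0.
Proof. by move=> lu lv; rewrite linearD !linearZ /= lu lv !scaler0 addr0. Qed.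

(** A constant subspace [K] of the ambient space that is tangent to [A] defines
    an involutive distribution on [A]: differentiating a [K]-valued field along
    a vector of [K] gives a value in [K] again.  Thus brackets cannot leave it.
    Writing [K] as a common kernel of functionals makes its closedness under
    derivatives immediate. *)
Lemma generated_field_kernel E (A : set E) (V : E -> set (E * E))
    (L : set {linear E -> R^o}) (K := [set v | forall l, L l -> l v = 0]) :
  finite_dim E -> (forall q, A q -> K `<=` tangent A q) ->
  (forall q, A q -> V q `<=` K `*` K) ->
  forall X, generated_field A V X -> forall q, A q -> (K `*` K) (X q).
Proof.
move=> fdE KA VK X GX; have fdEE := finite_dim_prod fdE fdE.
(* smoothness has to be carried along for the differential to be meaningful *)
suff [] : smooth_map A X /\ forall q, A q -> (K `*` K) (X q) by [].
elim: GX => {X}.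
- move=> X [sX XV]; split=> // q Aq.
  have [u [v [/(VK _ Aq)[Ku1 Ku2] /(VK _ Aq)[Kv1 Kv2] ->]]] := XV _ Aq.
  split=> l Ll; rewrite linearD ?linearN /=.
    by rewrite (Ku1 l Ll) (Kv1 l Ll) addr0.
  by rewrite (Ku2 l Ll) (Kv2 l Ll) oppr0 addr0.
- move=> X Y _ [sX KX] _ [sY KY]; split.
    move=> p Ap; have [X' [U [Up sX' XX]]] := sX _ Ap.
    have [Y' [W [Wp sY' YY]]] := sY _ Ap.
    exists (fun q => X' q + Y' q), (U `&` W); split=> //.
      have oUW := openI (smooth_open sX') (smooth_open sY').
      apply: smoothD; [apply: smooth_subset sX'|apply: smooth_subset sY'] => //;
      by move=> x [].
    by move=> q Aq [Uq Wq]; rewrite XX // YY.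
  move=> q Aq; have [X1 X2] := KX _ Aq; have [Y1 Y2] := KY _ Aq.
  by split=> l Ll; rewrite linearD (X1 l, X2 l) // (Y1 l, Y2 l) // addr0.
- move=> c X _ [sX KX]; split.
    move=> p Ap; have [X' [U [Up sX' XX]]] := sX _ Ap.
    exists (cplx_scale c \o X'), U; split=> //.
      exact: (smooth_comp_linear (cplx_scaleL E c)).
    by move=> q Aq Uq; rewrite /= XX.
  move=> q Aq; have [X1 X2] := KX _ Aq.
  by split=> l Ll /=; rewrite -?scaleNr kernel_comb ?X1 ?X2.
- move=> X Y _ [sX KX] _ [sY KY].
  have tan Z : (forall q, A q -> (K `*` K) (Z q)) ->
      forall q, A q -> ctangent A q (Z q).
    by move=> KZ q Aq; have [Z1 Z2] := KZ _ Aq; split; exact: KA.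
  split; first by apply: smooth_bracket => //; exact: tan.
  move=> q Aq.
  have KcdY Z Z' : smooth_map A Z' -> (forall q, A q -> (K `*` K) (Z q)) ->
      (forall q, A q -> (K `*` K) (Z' q)) ->
      (K `*` K) (cderivative A Z' q (Z q)).
    move=> sZ' KZ KZ'; have [tZ1 tZ2] := tan _ KZ q Aq.
    have K1 l v : L l -> tangent A q v -> l (differential A Z' q v).1 = 0.
      move=> Ll tv; have Z'0 x : A x -> (l \o fstL E E)%R (Z' x) = 0.
        by move=> Ax; apply: (KZ' _ Ax).1.
      exact: (differential_kernel fdEE sZ' Z'0 Aq tv).
    have K2 l v : L l -> tangent A q v -> l (differential A Z' q v).2 = 0.
      move=> Ll tv; have Z'0 x : A x -> (l \o sndL E E)%R (Z' x) = 0.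
        by move=> Ax; apply: (KZ' _ Ax).2.
      exact: (differential_kernel fdEE sZ' Z'0 Aq tv).
    split=> l Ll; rewrite /cderivative /= linearD -?scaleNr kernel_comb.
    - by rewrite (K1 l _ Ll tZ1) addr0.
    - exact: K1 Ll tZ2.
    - exact: K2 Ll tZ2.
    - by rewrite (K2 l _ Ll tZ1) addr0.
    - exact: K2 Ll tZ2.
    - exact: K1 Ll tZ2.
  have [Y1 Y2] := KcdY X Y sY KX KY; have [X1 X2] := KcdY Y X sX KY KX.
  by split=> l Ll; rewrite linearB (Y1 l, Y2 l) // (X1 l, X2 l) // subr0.
Qed.

End CRGeneralities.

(** * The complex plane and biholomorphisms *)

Section ComplexPlane.
Variable R : realType.

Lemma finite_dim_C2 : finite_dim (C2 R).
Proof.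
have fR := finite_dim_R R.
exact: finite_dim_prod (finite_dim_prod fR fR) (finite_dim_prod fR fR).
Qed.

Lemma JE (p : C2 R) : J p = ((- p.1.2, p.1.1), (- p.2.2, p.2.1)) :> C2 R.
Proof.
case: p => [[a b] [c d]]; rewrite /J /mkC2 /z1 /z2 -complexiE /=.
by rewrite !mul0r !mul1r !sub0r !add0r.
Qed.

Lemma T01E (w : C2 R * C2 R) : T01 w <-> w.2 = J w.1.
Proof.
have JJ (p : C2 R) : J (J p) = - p by case: p => [[a b] [c d]]; rewrite !JE.
have si : cplx_scale (- 'i) w = (w.2, - w.1).
  rewrite /cplx_scale -complexiE /= oppr0 !scale0r sub0r scaleN1r opprK.
  by rewrite scaleN1r add0r.
rewrite /T01 /= si; split=> [[-> _]//|e].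
by congr pair; rewrite e ?JJ.
Qed.

Lemma diff_inverse (E F : normedModType R) (U : set E) (V : set F) (f : E -> F)
    (g : F -> E) p v :
  smooth U f -> smooth V g -> (forall x, U x -> V (f x) /\ g (f x) = x) ->
  U p -> 'd g (f p) ('d f p v) = v.
Proof.
move=> sf sg gf Up; have [Vp gfp] := gf _ Up.
have df := smooth_differentiable sf Up; have dg := smooth_differentiable sg Vp.
have : \forall x \near p, (g \o f) x = id x.
  by near=> x; apply: (gf x _).2; near: x; exact: near_open (smooth_open sf) Up.
move=> /near_eq_differentiable /(_ (differentiable_comp df dg)) [_].
move=> /(congr1 (fun k => k v)) idE; have compE := diff_comp df dg.
rewrite -[LHS]/(('d g (f p) \o 'd f p) v) -compE -idE.
by rewrite (@diff_lin _ _ _ idfun) // => x; exact: cvg_id.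
Unshelve. all: by end_near.
Qed.

(** The vectors of type (0,1) are the [u + i J u], so a map whose differential
    commutes with [J] preserves them; it reflects them because its differential
    is injective. *)
Lemma induced_CR_equivalence (M N U V : set (C2 R)) (f g : C2 R -> C2 R) :
  M `<=` U -> N `<=` V -> smooth U f -> smooth V g ->
  (forall x, U x -> V (f x) /\ g (f x) = x) ->
  (forall x, M x -> N (f x)) ->
  (forall y, N y -> M (g y) /\ f (g y) = y) ->
  (forall p v, U p -> 'd f p (J v) = J ('d f p v)) ->
  CR_equivalence M (induced_CR M) N (induced_CR N) f.
Proof.
move=> MU NV sf sg gf fMN fg fJ; have fd2 := finite_dim_C2.
have smf := smooth_smooth_map MU sf; have smg := smooth_smooth_map NV sg.
have df : diffeomorphism M N f.
  split=> //; exists g; split=> //.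
  - by move=> y /fg[].
  - by move=> x /MU /gf[].
  - by move=> y /fg[].
split=> // p Mp; have Up := MU _ Mp.
have dfE v : tangent M p v -> differential M f p v = 'd f p v.
  exact: differential_smooth Mp Up sf.
apply/seteqP; split=> [_ [w [[t1 t2] /T01E Jw] <-]|w [[t1 t2] /T01E Jw]].
  split; first by split; exact: (tangent_differential fd2 smf fMN Mp).
  by apply/T01E; rewrite /= !dfE // Jw fJ.
have [v1 tv1 e1] := diffeomorphism_tangent_onto fd2 fd2 df Mp t1.
have [v2 tv2 e2] := diffeomorphism_tangent_onto fd2 fd2 df Mp t2.
exists (v1, v2); last by rewrite /cdifferential /= e1 e2; case: (w).
split=> //; apply/T01E => /=.
rewrite dfE // in e1; rewrite dfE // in e2.
have h2 := diff_inverse v2 sf sg gf Up.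
have h1 := diff_inverse (J v1) sf sg gf Up.
have dfv : 'd f p v2 = 'd f p (J v1).
  exact: etrans e2 (etrans Jw (etrans (congr1 _ (esym e1)) (esym (fJ p v1 Up)))).
exact: etrans (esym h2) (etrans (congr1 _ dfv) h1).
Qed.

End ComplexPlane.

(** * Derivatives of explicit maps *)

Section ExplicitDerivatives.
Variable R : realType.
Implicit Types E F G : normedModType R.

Lemma smooth_addr E (U : set E) (f g : E -> R^o) :
  smooth U f -> smooth U g -> smooth U (fun x => (f x : R) + (g x : R) : R^o).
Proof. exact: smoothD. Qed.

Lemma smooth_subr E (U : set E) (f g : E -> R^o) :
  smooth U f -> smooth U g -> smooth U (fun x => (f x : R) - (g x : R) : R^o).
Proof. exact: smoothB. Qed.

Lemma smooth_mulr E (U : set E) (f g : E -> R^o) :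
  smooth U f -> smooth U g -> smooth U (fun x => (f x : R) * (g x : R) : R^o).
Proof. exact: smooth_scale. Qed.

(** Unlike equations between differentials, this relation can be proved by
    applying rules along the shape of [f] alone, which computes [d]. *)
Definition has_diff E F (f : E -> F) (p v : E) (d : F) : Prop :=
  differentiable f p /\ 'd f p v = d.

Lemma has_diff_eq E F (f : E -> F) p v d d' :
  has_diff f p v d -> d = d' -> has_diff f p v d'.
Proof. by move=> ? <-. Qed.

Lemma has_diff_cst E F (a : F) (p v : E) : has_diff (fun=> a) p v 0.
Proof. by split; [exact: differentiable_cst|rewrite diff_cst]. Qed.

Lemma has_diff_linear E F (f : {linear E -> F}) (p v : E) : finite_dim E ->
  has_diff f p v (f v).
Proof.
move=> fdE; have fc := finite_dim_continuous (f := f) fdE.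
by split; [exact: linear_differentiable|rewrite (diff_lin _ fc)].
Qed.

Lemma has_diffD E F (f g : E -> F) p v df dg :
  has_diff f p v df -> has_diff g p v dg ->
  has_diff (fun x => f x + g x) p v (df + dg).
Proof.
move=> [cf <-] [cg <-]; split; first exact: differentiableD cf cg.
exact: (congr1 (fun h => h v) (diffD cf cg)).
Qed.

Lemma has_diff_scale E F (k : E -> R^o) (f : E -> F) p v dk df :
  has_diff k p v dk -> has_diff f p v df ->
  has_diff (fun x => k x *: f x) p v (k p *: df + (dk : R) *: f p).
Proof.
move=> [ck <-] [cf <-]; have [dkf e] := differentiable_scale ck cf.
by split; [exact: dkf|exact: (congr1 (fun h => h v) e)].
Qed.

Lemma has_diff_pair E F G (f : E -> F) (g : E -> G) p v df dg :
  has_diff f p v df -> has_diff g p v dg ->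
  has_diff (fun x => (f x, g x)) p v (df, dg).
Proof.
move=> [cf <-] [cg <-]; split; first exact: differentiable_pair cf cg.
exact: (congr1 (fun h => h v) (diff_pair cf cg)).
Qed.

Lemma has_diff_addr E (f g : E -> R^o) p v (df dg : R) :
  has_diff f p v df -> has_diff g p v dg ->
  has_diff (fun x => (f x : R) + (g x : R) : R^o) p v (df + dg).
Proof. exact: has_diffD. Qed.

Lemma has_diff_mulr E (f g : E -> R^o) p v (df dg : R) :
  has_diff f p v df -> has_diff g p v dg ->
  has_diff (fun x => (f x : R) * (g x : R) : R^o) p v
    ((f p : R) * dg + df * (g p : R)).
Proof. exact: has_diff_scale. Qed.

Lemma has_diff_subr E (f g : E -> R^o) p v (df dg : R) :
  has_diff f p v df -> has_diff g p v dg ->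
  has_diff (fun x => (f x : R) - (g x : R) : R^o) p v (df - dg).
Proof.
move=> hf hg.
have := has_diffD hf (has_diff_scale (has_diff_cst (-1 : R^o) p v) hg).
rewrite scale0r addr0 scaleN1r => -[cf e].
have fE : (fun x => f x + (-1 : R^o) *: g x) = (fun x => f x - g x).
  by apply/funext => x; rewrite scaleN1r.
by rewrite fE in cf e *; split.
Qed.

Lemma has_diff_inv E (f : E -> R^o) p v (df : R) : f p != 0 ->
  has_diff f p v df ->
  has_diff (fun x => (f x : R)^-1 : R^o) p v (- (f p : R)^-1 ^+ 2 * df).
Proof.
move=> f0 [cf <-]; split; first exact: differentiableV cf f0.
by rewrite exprVn; exact: (congr1 (fun h => h v) (diffV cf f0)).
Qed.

Lemma smooth_entry (U : set 'M[R]_3) (i j : 'I_3) :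
  open U -> smooth U (fun M : 'M[R]_3 => M i j : R^o).
Proof. exact: (smooth_linear (entry R i j) (finite_dim_mx R 3 3)). Qed.

Lemma has_diff_entry (i j : 'I_3) (p v : 'M[R]_3) :
  has_diff (fun M : 'M[R]_3 => M i j : R^o) p v (v i j).
Proof. exact: (has_diff_linear (entry R i j) p v (finite_dim_mx R 3 3)). Qed.

Definition re1L : {linear C2 R -> R^o} :=
  (fstL R^o R^o \o fstL (R^o * R^o)%type (R^o * R^o)%type)%R.
Definition im1L : {linear C2 R -> R^o} :=
  (sndL R^o R^o \o fstL (R^o * R^o)%type (R^o * R^o)%type)%R.
Definition re2L : {linear C2 R -> R^o} :=
  (fstL R^o R^o \o sndL (R^o * R^o)%type (R^o * R^o)%type)%R.
Definition im2L : {linear C2 R -> R^o} :=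
  (sndL R^o R^o \o sndL (R^o * R^o)%type (R^o * R^o)%type)%R.

Lemma smooth_re1 U : open U -> smooth U (fun p : C2 R => p.1.1 : R^o).
Proof. exact: (smooth_linear re1L (finite_dim_C2 R)). Qed.
Lemma smooth_im1 U : open U -> smooth U (fun p : C2 R => p.1.2 : R^o).
Proof. exact: (smooth_linear im1L (finite_dim_C2 R)). Qed.
Lemma smooth_re2 U : open U -> smooth U (fun p : C2 R => p.2.1 : R^o).
Proof. exact: (smooth_linear re2L (finite_dim_C2 R)). Qed.
Lemma smooth_im2 U : open U -> smooth U (fun p : C2 R => p.2.2 : R^o).
Proof. exact: (smooth_linear im2L (finite_dim_C2 R)). Qed.

Lemma has_diff_re1 (p v : C2 R) :
  has_diff (fun p : C2 R => p.1.1 : R^o) p v v.1.1.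
Proof. exact: (has_diff_linear re1L p v (finite_dim_C2 R)). Qed.
Lemma has_diff_im1 (p v : C2 R) :
  has_diff (fun p : C2 R => p.1.2 : R^o) p v v.1.2.
Proof. exact: (has_diff_linear im1L p v (finite_dim_C2 R)). Qed.
Lemma has_diff_re2 (p v : C2 R) :
  has_diff (fun p : C2 R => p.2.1 : R^o) p v v.2.1.
Proof. exact: (has_diff_linear re2L p v (finite_dim_C2 R)). Qed.
Lemma has_diff_im2 (p v : C2 R) :
  has_diff (fun p : C2 R => p.2.2 : R^o) p v v.2.2.
Proof. exact: (has_diff_linear im2L p v (finite_dim_C2 R)). Qed.

Lemma smooth_C2 E (U : set E) (f g h k : E -> R^o) :
  smooth U f -> smooth U g -> smooth U h -> smooth U k ->
  smooth U (fun x => ((f x, g x), (h x, k x)) : C2 R).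
Proof.
move=> sf sg sh sk; exact: smooth_pair (smooth_pair sf sg) (smooth_pair sh sk).
Qed.

Lemma has_diff_C2 E (f g h k : E -> R^o) (p v : E) (a b c d : R) :
  has_diff f p v a -> has_diff g p v b -> has_diff h p v c -> has_diff k p v d ->
  has_diff (fun x => ((f x, g x), (h x, k x)) : C2 R) p v ((a, b), (c, d)).
Proof.
move=> hf hg hh hk.
exact: has_diff_pair (has_diff_pair hf hg) (has_diff_pair hh hk).
Qed.

End ExplicitDerivatives.

Ltac smooth_real oU :=
  repeat first [ assumption | exact: (smooth_cst _ oU)
    | exact: (smooth_entry _ _ oU)
    | exact: (smooth_re1 oU) | exact: (smooth_im1 oU)
    | exact: (smooth_re2 oU) | exact: (smooth_im2 oU)
    | apply: smooth_mulr | apply: smooth_subr | apply: smooth_addr ].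

Ltac has_diff_real :=
  repeat first [ exact: has_diff_cst | exact: has_diff_entry
    | exact: has_diff_re1 | exact: has_diff_im1
    | exact: has_diff_re2 | exact: has_diff_im2
    | apply: has_diff_mulr | apply: has_diff_subr | apply: has_diff_addr ].

(** * The Heisenberg group and its invariant fields *)

Section Heisenberg.
Variable R : realType.
Implicit Types x y z a b c : R.
Local Notation H := (@heisenberg R).
Local Notation M3 := ('M[R]_3 : normedModType R).

Let fdM : finite_dim M3 := finite_dim_mx R 3 3.

Definition hpt x y z : 'M[R]_3 :=
  1%:M + x *: delta_mx 0 1 + y *: delta_mx 1 2%:R + z *: delta_mx 0 2%:R.

Definition hvec a b c : 'M[R]_3 :=
  a *: delta_mx 0 1 + b *: delta_mx 1 2%:R + c *: delta_mx 0 2%:R.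

Lemma heisenbergP (g : 'M[R]_3) : H g -> exists x y z, g = hpt x y z.
Proof. by []. Qed.

Lemma heisenberg_hpt x y z : H (hpt x y z).
Proof. by exists x, y, z. Qed.

Lemma hptE x y z :
  (hpt x y z 0 1 = x) * (hpt x y z 1 2%:R = y) * (hpt x y z 0 2%:R = z).
Proof. by rewrite /hpt !mxE /= !(mulr0, mulr1, addr0, add0r). Qed.

Lemma hvecE a b c :
  (hvec a b c 0 1 = a) * (hvec a b c 1 2%:R = b) * (hvec a b c 0 2%:R = c).
Proof. by rewrite /hvec !mxE /= !(mulr0, mulr1, addr0, add0r). Qed.

Lemma eq_hpt x y z x' y' z' :
  x = x' -> y = y' -> z = z' -> hpt x y z = hpt x' y' z'.
Proof. by move=> -> -> ->. Qed.

Lemma eq_hvec x y z x' y' z' :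
  x = x' -> y = y' -> z = z' -> hvec x y z = hvec x' y' z'.
Proof. by move=> -> -> ->. Qed.

Lemma hpt_add x y z a b c :
  hpt x y z + hvec a b c = hpt (x + a) (y + b) (z + c).
Proof. by apply/matrixP => i j; rewrite !mxE; ring. Qed.

Lemma hvec_comb k l a b c a' b' c' :
  k *: hvec a b c + l *: hvec a' b' c' =
  hvec (k * a + l * a') (k * b + l * b') (k * c + l * c').
Proof. by apply/matrixP => i j; rewrite /hvec !mxE; ring. Qed.

Lemma hpt_hvec x y z a b c :
  hpt x y z *m hvec a b c = hvec a b (c + x * b).
Proof.
rewrite /hpt /hvec !(mulmxDl, mulmxDr) !mul1mx -!scalemxAl -!scalemxAr.
rewrite !mul_delta_mx_cond /= !mulr0n mulr1n !scaler0 !addr0 scalerA scalerDl.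
by apply/matrixP => i j; rewrite !mxE; ring.
Qed.

Lemma hptM x y z a b c :
  hpt x y z *m hpt a b c = hpt (x + a) (y + b) (z + c + x * b).
Proof.
have -> : hpt a b c = 1%:M + hvec a b c by rewrite /hpt /hvec !addrA.
by rewrite mulmxDr mulmx1 hpt_hvec hpt_add addrA.
Qed.

Lemma hvecM a b c a' b' c' :
  hvec a b c *m hvec a' b' c' = hvec 0 0 (a * b').
Proof.
have := hpt_hvec a b c a' b' c'.
have -> : hpt a b c = 1%:M + hvec a b c by rewrite /hpt /hvec !addrA.
rewrite mulmxDl mul1mx => /(canRL (addKr _)) ->.
by apply/matrixP => i j; rewrite /hvec !mxE; ring.
Qed.

Lemma heisenberg1 : H 1%:M.
Proof. by exists 0, 0, 0; rewrite !scale0r !addr0. Qed.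

Lemma heisenbergM g h : H g -> H h -> H (g *m h).
Proof.
move=> /heisenbergP[x [y [z ->]]] /heisenbergP[a [b [c ->]]].
by rewrite hptM; exact: heisenberg_hpt.
Qed.

Definition heis_alg : set 'M[R]_3 := [set v | exists a b c, v = hvec a b c].

Lemma heis_alg_hvec a b c : heis_alg (hvec a b c).
Proof. by exists a, b, c. Qed.

Lemma heis_alg_comb k l v w :
  heis_alg v -> heis_alg w -> heis_alg (k *: v + l *: w).
Proof.
move=> [a [b [c ->]]] [a' [b' [c' ->]]]; rewrite hvec_comb.
exact: heis_alg_hvec.
Qed.

Lemma heis_alg_mul g v : H g -> heis_alg v -> heis_alg (g *m v).
Proof.
move=> /heisenbergP[x [y [z ->]]] [a [b [c ->]]].
by rewrite hpt_hvec; exact: heis_alg_hvec.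
Qed.

Lemma smooth_hpt (E : normedModType R) (U : set E) (f g h : E -> R^o) :
  smooth U f -> smooth U g -> smooth U h ->
  smooth U (fun u => hpt (f u) (g u) (h u) : M3).
Proof.
move=> sf sg sh; have oU := smooth_open sf.
have sm k (i j : 'I_3) : smooth U k ->
    smooth U (fun u : E => (k u : R) *: (delta_mx i j : M3)).
  by move=> sk; exact: smooth_scale sk (smooth_cst _ oU).
have s1 := smoothD (smooth_cst (1%:M : M3) oU) (sm f 0 1 sf).
exact: smoothD (smoothD s1 (sm g _ _ sg)) (sm h _ _ sh).
Qed.

Lemma has_diff_hpt (E : normedModType R) (f g h : E -> R^o) p v a b c :
  has_diff f p v a -> has_diff g p v b -> has_diff h p v c ->
  has_diff (fun u => hpt (f u) (g u) (h u) : M3) p v (hvec a b c).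
Proof.
move=> hf hg hh.
have hm k d (i j : 'I_3) : has_diff k p v d ->
    has_diff (fun u : E => (k u : R) *: (delta_mx i j : M3)) p v
      ((d : R) *: delta_mx i j).
  move=> hk; apply: has_diff_eq (has_diff_scale hk (has_diff_cst _ p v)) _.
  by rewrite scaler0 add0r.
have h1 := has_diffD (has_diff_cst (1%:M : M3) p v) (hm f _ 0 1 hf).
apply: has_diff_eq (has_diffD (has_diffD h1 (hm g _ _ _ hg)) (hm h _ _ _ hh)) _.
by rewrite add0r.
Qed.

Lemma heis_defect_linear :
  linear (fun M : M3 => M - hvec (M 0 1) (M 1 2%:R) (M 0 2%:R) : M3).
Proof. by move=> k M N; apply/matrixP => i j; rewrite /hvec !mxE; ring. Qed.

(** Its entries are linear equations of the Lie algebra, in a form to which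
    [differential_kernel] and [generated_field_kernel] apply. *)
Definition heis_defect : {linear M3 -> M3} :=
  HB.pack (fun M : M3 => M - hvec (M 0 1) (M 1 2%:R) (M 0 2%:R) : M3)
    (GRing.isLinear.Build _ _ _ _ _ heis_defect_linear).

Lemma heis_defect_eq0 v :
  heis_defect v = 0 -> v = hvec (v 0 1) (v 1 2%:R) (v 0 2%:R).
Proof. by move=> /eqP; rewrite subr_eq0 => /eqP. Qed.

Lemma heis_defect_hvec a b c : heis_defect (hvec a b c) = 0.
Proof. by rewrite /= !hvecE subrr. Qed.

Lemma tangent_hvec (U : set M3) p a b c : open U -> H p -> U p ->
  tangent (H `&` U) p (hvec a b c).
Proof.
move=> oU Hp Up.
have sl : smooth setT (fun t : R^o => p + (t : R) *: hvec a b c : M3).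
  apply: smoothD (smooth_cst _ openT) (smooth_scale _ (smooth_cst _ openT)).
  exact: (smooth_linear (idfun : {linear R^o -> R^o}) (finite_dim_R R) openT).
apply: (tangent_line (open_smooth_preimage sl oU)).
  by split=> //=; rewrite scale0r addr0.
move=> t [_ /= Ut]; split=> //; have [x [y [z ->]]] := heisenbergP Hp.
have -> : t *: hvec a b c = hvec (t * a) (t * b) (t * c).
  by rewrite /hvec !scalerDr !scalerA.
by rewrite hpt_add; exact: heisenberg_hpt.
Qed.

Lemma tangent_heisenberg p v : H p -> tangent H p v <-> heis_alg v.
Proof.
move=> Hp; split=> [tv|[a [b [c ->]]]]; last first.
  by have := @tangent_hvec setT p a b c openT Hp Logic.I; rewrite setIT.
exists (v 0 1), (v 1 2%:R), (v 0 2%:R).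
have sid : smooth setT (fun M : M3 => M - 1%:M : M3).
  apply: smoothB (smooth_cst _ openT).
  exact: (smooth_linear (idfun : {linear M3 -> M3}) fdM openT).
have HD M : H M -> heis_defect (M - 1%:M) = 0.
  move=> /heisenbergP[x [y [z ->]]].
  by rewrite /hpt /= !mxE; apply/matrixP => i j; rewrite /hvec !mxE /=; ring.
have := differential_kernel fdM (smooth_smooth_map (@subsetT _ H) sid) HD Hp tv.
rewrite (differential_smooth Hp Logic.I sid tv).
have hid := has_diff_linear (idfun : {linear M3 -> M3}) p v fdM.
have [_ e] := has_diffD hid (has_diff_cst (- (1%:M : M3)) p v).
by rewrite e addr0 => /heis_defect_eq0.
Qed.

Lemma smooth_mulmx (U : set M3) (g : 'M[R]_3) :
  open U -> smooth U (mulmx g : M3 -> M3).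
Proof. exact: (smooth_linear (mulmx g : {linear M3 -> M3}) fdM). Qed.

Lemma differential_mulmx (g : 'M[R]_3) (p v : M3) : H p -> tangent H p v ->
  differential (H : set M3) (mulmx g : M3 -> M3) p v = g *m v.
Proof.
move=> Hp tv; rewrite (differential_smooth Hp Logic.I (smooth_mulmx g openT) tv).
by have [_] := has_diff_linear (mulmx g : {linear M3 -> M3}) p v fdM.
Qed.

Lemma diffeomorphism_mulmx (g : 'M[R]_3) : H g ->
  diffeomorphism (H : set M3) (H : set M3) (mulmx g : M3 -> M3).
Proof.
have sm h : smooth_map (H : set M3) (mulmx h : M3 -> M3).
  exact: smooth_smooth_map (@subsetT _ _) (smooth_mulmx h openT).
move=> Hg; split; [exact: sm|by move=> h; exact: heisenbergM|].
have [x [y [z gE]]] := heisenbergP Hg.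
have hg : hpt (- x) (- y) (x * y - z) *m g = 1%:M.
  rewrite gE hptM; apply/matrixP => i j; rewrite /hpt !mxE; ring.
have gh : g *m hpt (- x) (- y) (x * y - z) = 1%:M.
  rewrite gE hptM; apply/matrixP => i j; rewrite /hpt !mxE; ring.
exists (mulmx (hpt (- x) (- y) (x * y - z))); split; first exact: sm.
- by move=> h; apply: heisenbergM; exact: heisenberg_hpt.
- by move=> h _; rewrite mulmxA hg mul1mx.
- by move=> h _; rewrite mulmxA gh mul1mx.
Qed.

Lemma submanifold_heisenberg : submanifold 3 (H : set M3).
Proof.
move=> p Hp.
exists setT, setT, (fun v : 'rV[R]_3 => hpt (v 0 0) (v 0 1) (v 0 2%:R)).
rewrite setIT; split=> //; try exact: openT.
have se (i : 'I_3) : smooth setT (fun v : 'rV[R]_3 => v 0 i : R^o).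
  exact: (smooth_linear (entry R 0 i) (finite_dim_mx R 1 3) openT).
split.
- apply: smooth_smooth_map (@subsetT _ _) _.
  exact: smooth_hpt (se 0) (se 1) (se 2%:R).
- by move=> v _; exact: heisenberg_hpt.
pose c (M : M3) : 'rV[R]_3 := \row_(i < 3)
  (if i == 0 then M 0 1 else if i == 1 then M 1 2%:R else M 0 2%:R).
have cl : linear c.
  move=> k M N; apply/rowP => i; rewrite !mxE.
  by case: (i == 0); case: (i == 1).
pose cL : {linear M3 -> 'rV[R]_3} :=
  HB.pack c (GRing.isLinear.Build _ _ _ _ c cl).
exists c; split=> //.
- exact: smooth_smooth_map (@subsetT _ _) (smooth_linear cL fdM openT).
- move=> v _; apply/rowP => -[[|[|[|]]] // i3]; rewrite /c mxE /= ?hptE;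
  congr (v 0 _); exact: val_inj.
- move=> M /heisenbergP[x [y [z ->]]].
  have c0 : c (hpt x y z) 0 0 = x by rewrite mxE /= hptE.
  have c1 : c (hpt x y z) 0 1 = y by rewrite mxE /= hptE.
  have c2 : c (hpt x y z) 0 2%:R = z by rewrite mxE /= hptE.
  by rewrite c0 c1 c2.
Qed.

Definition invariant_field (w : M3 * M3) (g : M3) : M3 * M3 :=
  (g *m w.1, g *m w.2).

Lemma invariant_field_linear w : linear (invariant_field w).
Proof. by move=> k M N; congr pair; rewrite mulmxDl -scalemxAl. Qed.

Definition invariant_fieldL w : {linear M3 -> (M3 * M3)%type} :=
  HB.pack (invariant_field w)
    (GRing.isLinear.Build _ _ _ _ _ (invariant_field_linear w)).

Lemma smooth_map_invariant_field A w : smooth_map A (invariant_field w).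
Proof.
apply: smooth_smooth_map (@subsetT _ _) _.
exact: (smooth_linear (invariant_fieldL w) fdM openT).
Qed.

Lemma differential_invariant_field w p v : H p -> tangent H p v ->
  differential (H : set M3) (invariant_field w) p v = invariant_field w v.
Proof.
move=> Hp tv; have sw := smooth_linear (invariant_fieldL w) fdM openT.
rewrite (differential_smooth Hp Logic.I sw tv).
by have [_] := has_diff_linear (invariant_fieldL w) p v fdM.
Qed.

Definition invariant_line (w : M3 * M3) (g : M3) : set (M3 * M3) :=
  [set cplx_scale k (invariant_field w g) | k in setT].

Lemma invariant_line_ctangent w g : heis_alg w.1 -> heis_alg w.2 -> H g ->
  invariant_line w g `<=` ctangent H g.
Proof.
move=> w1 w2 Hg _ [k _ <-].
have g1 := heis_alg_mul Hg w1; have g2 := heis_alg_mul Hg w2.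
split; apply/(tangent_heisenberg _ Hg) => /=; rewrite -?scaleNr;
exact: heis_alg_comb.
Qed.

Lemma invariant_line_equivalence f w w' :
  diffeomorphism (H : set M3) (H : set M3) f ->
  (forall p, H p -> differential (H : set M3) f p (p *m w.1) = f p *m w'.1) ->
  (forall p, H p -> differential (H : set M3) f p (p *m w.2) = f p *m w'.2) ->
  CR_equivalence (H : set M3) (invariant_line w) H (invariant_line w') f.
Proof.
move=> df f1 f2; split=> // p Hp.
rewrite /invariant_line image_comp; apply: eq_imagel => k _.
by rewrite /= cdifferential_scale /cdifferential /= f1 // f2.
Qed.

Lemma left_invariant_line w : heis_alg w.1 -> heis_alg w.2 ->
  left_invariant (H : set M3) (@mulmx R 3 3 3) (invariant_line w).
Proof.
move=> w1 w2 g Hg; apply: invariant_line_equivalence => [|p Hp|p Hp].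
- exact: diffeomorphism_mulmx.
- apply: etrans (mulmxA _ _ _); apply: differential_mulmx => //.
  by apply/(tangent_heisenberg _ Hp); exact: heis_alg_mul.
- apply: etrans (mulmxA _ _ _); apply: differential_mulmx => //.
  by apply/(tangent_heisenberg _ Hp); exact: heis_alg_mul.
Qed.

End Heisenberg.

(** * The invariant CR structure *)

Section HeisenbergCR.
Variable R : realType.
Local Notation H := (@heisenberg R).
Local Notation M3 := ('M[R]_3 : normedModType R).

Let fdM : finite_dim M3 := finite_dim_mx R 3 3.

Definition heis_L : M3 * M3 := (hvec 1 0 0, hvec 0 1 0).

Definition heis_Lbar : M3 * M3 := (hvec 1 0 0, hvec 0 (-1) 0).

Lemma heisenberg_LE : heisenberg_L R = heis_L.
Proof.
rewrite /heisenberg_L -complexiE; congr pair; apply/matrixP => i j;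
rewrite !mxE; do 2![case: (_ && _)]; rewrite ?mulr0 ?mulr1 /=; ring.
Qed.

Lemma heisenberg_VE g : H g -> heisenberg_V g = invariant_line heis_L g.
Proof.
move=> Hg; rewrite /heisenberg_V heisenberg_LE /invariant_line image_comp.
apply: eq_imagel => k _; rewrite /= cdifferential_scale; congr cplx_scale.
have H1 := heisenberg1 R; congr pair; apply: (differential_mulmx _ H1);
apply/(tangent_heisenberg _ H1); exact: heis_alg_hvec.
Qed.

(** With [X], [Y] the real and imaginary parts of [L] and [Z] their bracket,
    this is the identity [[X + i Y, X - i Y] = - 2 i Z]. *)
Lemma bracket_heis_L p : H p ->
  bracket (H : set M3) (invariant_field heis_L) (invariant_field heis_Lbar) p =
  (hvec 0 0 0, hvec 0 0 (- 2)).
Proof.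
move=> Hp; have [x [y [z pE]]] := heisenbergP Hp.
have tp a b c : tangent (H : set M3) p (hvec a b c).
  by apply/(tangent_heisenberg _ Hp); exact: heis_alg_hvec.
have LE : invariant_field heis_L p = (hvec 1 0 0, hvec 0 1 x).
  by rewrite pE /invariant_field !hpt_hvec !(mulr0, mulr1, add0r).
have LbE : invariant_field heis_Lbar p = (hvec 1 0 0, hvec 0 (-1) (- x)).
  by rewrite pE /invariant_field !hpt_hvec !(mulr0, mulrN1, add0r).
rewrite /bracket /cderivative LE LbE.
rewrite !(differential_invariant_field _ Hp (tp _ _ _)) /invariant_field !hvecM.
rewrite /cplx_scale -complexiE /=.
by congr pair; apply/matrixP => i j; rewrite /hvec !mxE /=; ring.
Qed.

Lemma section_invariant_field :
  section_VVbar (H : set M3) (@heisenberg_V R) (invariant_field heis_L) /\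
  section_VVbar (H : set M3) (@heisenberg_V R) (invariant_field heis_Lbar).
Proof.
have c1 (w : M3 * M3) : cplx_scale 1 w = w.
  by rewrite /cplx_scale /= !scale1r !scale0r subr0 addr0; case: w.
have c0 (w : M3 * M3) : cplx_scale 0 w = 0.
  by rewrite /cplx_scale /= !scale0r subr0 addr0.
split; split; try exact: smooth_map_invariant_field.
  move=> q Hq; rewrite heisenberg_VE //; exists (invariant_field heis_L q), 0.
  split; [by exists 1|by exists 0|].
  by rewrite /cplx_conj /= oppr0; congr pair; rewrite /= addr0.
move=> q Hq; rewrite heisenberg_VE //; exists 0, (invariant_field heis_L q).
split; [by exists 0|by exists 1|].
rewrite /cplx_conj /=; congr pair; rewrite /= add0r // -mulmxN.
by congr (_ *m _); apply/matrixP => i j; rewrite /hvec !mxE; ring.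
Qed.

Lemma bracket_generating_heisenberg :
  bracket_generating (H : set M3) (@heisenberg_V R).
Proof.
move=> p [w1 w2] Hp.
move=> [/(tangent_heisenberg _ Hp)[a [b [c w1E]]]].
move=> /(tangent_heisenberg _ Hp)[a' [b' [c' w2E]]].
have [/generated_section gL /generated_section gLb] := section_invariant_field.
have gZ := generated_bracket gL gLb.
have [x [y [z pE]]] := heisenbergP Hp.
(* the coefficients of (w1, w2) on L, its conjugate and their bracket *)
pose al := Complex ((a + b') / 2) ((a' - b) / 2).
pose be := Complex ((a - b') / 2) ((a' + b) / 2).
pose ga := Complex (- (c' - x * b') / 2) ((c - x * b) / 2).
have gLL := generated_add (generated_scale al gL) (generated_scale be gLb).
have := generated_add gLL (generated_scale ga gZ).
set X := (X in generated_field _ _ X) => gX.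
exists setT, X; rewrite setIT; split=> //; first exact: openT.
rewrite /X bracket_heis_L // /invariant_field /= pE !hpt_hvec.
rewrite /= in w1E w2E; rewrite w1E w2E.
by congr pair; apply/matrixP => i j; rewrite /hvec !mxE /=; field.
Qed.

Lemma CR_structure_heisenberg : CR_structure (H : set M3) (@heisenberg_V R).
Proof.
split; [exact: submanifold_heisenberg| | |exact: bracket_generating_heisenberg].
- move=> p Hp; exists setT, (invariant_field heis_L); rewrite setIT.
  split=> //; [exact: openT|exact: smooth_map_invariant_field|].
  move=> q Hq _; rewrite heisenberg_VE //; split=> //.
    by split; apply/(tangent_heisenberg _ Hq); apply: heis_alg_mul => //;
       exact: heis_alg_hvec.
  have [x [y [z ->]]] := heisenbergP Hq.
  apply/eqP => /(congr1 (fun u : M3 * M3 => u.1 0 1)).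
  rewrite /invariant_field /= hpt_hvec hvecE mxE => /eqP.
  by rewrite oner_eq0.
- move=> p Hp; rewrite heisenberg_VE //.
  apply/seteqP; split=> [u [[k _ <-]]|_ ->].
    move=> [_ [l _ <-]]; have [x [y [z ->]]] := heisenbergP Hp.
    rewrite /cplx_conj /cplx_scale /invariant_field /= !hpt_hvec => e.
    have e1 (i j : 'I_3) := congr1 (fun u : M3 * M3 => u.1 i j) e.
    have e2 (i j : 'I_3) := congr1 (fun u : M3 * M3 => u.2 i j) e.
    have := (e1 0 1, e1 1 2%:R, e2 0 1, e2 1 2%:R).
    rewrite /= !mxE /= => -[[[h1 h2] h3] h4].
    have k1 : complex.Re k = 0 by lra.
    have k2 : complex.Im k = 0 by lra.
    by rewrite k1 k2 !scale0r subr0 addr0.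
  have c0 : cplx_scale 0 (invariant_field heis_L p) = 0.
    by rewrite /cplx_scale /= !scale0r subr0 addr0.
  by split; [exists 0|exists 0; [exists 0|rewrite /cplx_conj /= oppr0]].
Qed.

Lemma left_invariant_heisenberg :
  left_invariant (H : set M3) (@mulmx R 3 3 3) (@heisenberg_V R).
Proof.
move=> g Hg; have VE q (Hq : H q) := esym (heisenberg_VE Hq).
by apply: (CR_equivalence_eq VE VE); apply: left_invariant_line => //;
   exact: heis_alg_hvec.
Qed.

(** * Uniqueness up to automorphism *)

Lemma invariant_CR_line W : CR_structure (H : set M3) W ->
  left_invariant (H : set M3) (@mulmx R 3 3 3) W ->
  exists w, [/\ heis_alg w.1, heis_alg w.2 &
    forall g, H g -> W g = invariant_line w g].
Proof.
move=> [_ Wl _ _] Wi; have H1 := heisenberg1 R.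
have [U [L [_ U1 _ /(_ _ H1 U1)]]] := Wl _ H1.
move=> [[t1 t2] _ W1]; exists (L 1%:M).
split; [exact/(tangent_heisenberg _ H1)|exact/(tangent_heisenberg _ H1)|].
move=> g Hg; have [_ /(_ _ H1)] := Wi _ Hg; rewrite mulmx1 => <-.
rewrite W1 /invariant_line image_comp; apply: eq_imagel => k _.
rewrite /= cdifferential_scale; congr cplx_scale.
by congr pair; exact: differential_mulmx.
Qed.

(** If the real and imaginary parts of the spanning vector have proportional
    images in the abelianization, both are killed by a nonzero functional
    [l1 * a + l2 * b] on the Lie algebra.  Left translations do not change the
    entries [a], [b], so its kernel defines a left-invariant distribution that is
    constant in matrix coordinates, and no bracket reaches the direction
    [(l1, l2, 0)] transverse to it. *)
Lemma bracket_generating_det a b c a' b' c' (W : M3 -> set (M3 * M3)) :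
  (forall g, H g -> W g = invariant_line (hvec a b c, hvec a' b' c') g) ->
  bracket_generating (H : set M3) W -> a * b' - a' * b != 0.
Proof.
move=> WE Wb; apply/eqP => D0.
have [[l1 l2] /= [lne la la']] : exists l : R * R,
    [/\ l.1 ^+ 2 + l.2 ^+ 2 != 0, l.1 * a + l.2 * b = 0 &
        l.1 * a' + l.2 * b' = 0].
  have [ab|ab] := eqVneq (a ^+ 2 + b ^+ 2) 0.
    have /andP[/eqP a0 /eqP b0] : (a == 0) && (b == 0).
      by move/eqP: ab; rewrite paddr_eq0 ?sqr_ge0 // !sqrf_eq0.
    have [ab'|ab'] := eqVneq (a' ^+ 2 + b' ^+ 2) 0.
      have /andP[/eqP a0' /eqP b0'] : (a' == 0) && (b' == 0).
        by move/eqP: ab'; rewrite paddr_eq0 ?sqr_ge0 // !sqrf_eq0.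
      exists (1, 0); rewrite a0 b0 a0' b0' /= !mulr0 addr0 expr1n expr0n addr0.
      by rewrite oner_neq0.
    exists (b', - a'); split=> /=; [by rewrite sqrrN addrC| |ring].
    by rewrite a0 b0; ring.
  exists (b, - a); split=> /=; [by rewrite sqrrN addrC|ring|].
  by rewrite -[RHS]oppr0 -[in RHS]D0; ring.
pose L : set {linear M3 -> R^o} :=
  [set lam | forall a b c, l1 * a + l2 * b = 0 -> lam (hvec a b c) = 0].
pose K : set M3 := [set v | forall l, L l -> l v = 0].
have H1 := heisenberg1 R.
have [U [X [oU U1 gX X1]]] : exists (U : set M3) (X : M3 -> M3 * M3),
    [/\ open U, U 1%:M, generated_field (H `&` U) W X &
        X 1%:M = (hvec l1 l2 0, hvec 0 0 0)].
  by apply: Wb => //; split; apply/(tangent_heisenberg _ H1);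
     exact: heis_alg_hvec.
have Ktan q : (H `&` U) q -> K `<=` tangent (H `&` U) q.
  move=> [Hq Uq] v Kv; have -> := @heis_defect_eq0 R v.
    exact: tangent_hvec.
  apply/matrixP => i j; rewrite [RHS]mxE.
  apply: (Kv (entry R i j \o @heis_defect R)%R) => x y z _.
  by rewrite -[LHS]/(heis_defect _ (hvec x y z) i j) heis_defect_hvec mxE.
have comb k m u v u' v' : l1 * u + l2 * v = 0 -> l1 * u' + l2 * v' = 0 ->
    l1 * (k * u + m * u') + l2 * (k * v + m * v') = 0.
  move=> e e'; have eE : l1 * (k * u + m * u') + l2 * (k * v + m * v') =
    k * (l1 * u + l2 * v) + m * (l1 * u' + l2 * v') by ring.
  by rewrite eE e e' !mulr0 addr0.
have WK q : (H `&` U) q -> W q `<=` K `*` K.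
  move=> [Hq Uq]; rewrite WE // => _ [k _ <-].
  have [x [y [z ->]]] := heisenbergP Hq; rewrite /invariant_field /= !hpt_hvec.
  split=> l Ll /=; rewrite -?scaleNr hvec_comb; apply: Ll.
    exact: comb la la'.
  exact: comb la' la.
have [K1 _] := generated_field_kernel fdM Ktan WK gX (conj H1 U1).
have ll : linear (fun M : M3 => l1 * M 0 1 + l2 * M 1 2%:R : R^o).
  by move=> k M N; rewrite !mxE -[RHS]/(k * _ + _); ring.
pose lam : {linear M3 -> R^o} :=
  HB.pack (fun M : M3 => l1 * M 0 1 + l2 * M 1 2%:R : R^o)
    (GRing.isLinear.Build _ _ _ _ _ ll).
have Llam : L lam by move=> x y z; rewrite /= !hvecE.
by move: (K1 _ Llam); rewrite X1 /= !hvecE -!expr2 => /eqP; exact/negP.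
Qed.

(** The group homomorphism that integrates the Lie algebra homomorphism with
    [X |-> (a, b, c)] and [Y |-> (a', b', c')].  In the exponential coordinates
    [(x, y, z - x * y / 2)] it is the linear map that multiplies the center by
    the determinant. *)
Definition heis_hom (a b c a' b' c' : R) (M : M3) : M3 :=
  hpt (a * M 0 1 + a' * M 1 2%:R) (b * M 0 1 + b' * M 1 2%:R)
    ((a * b' - a' * b) * (M 0 2%:R - M 0 1 * M 1 2%:R * 2^-1)
     + (c * M 0 1 + c' * M 1 2%:R)
     + (a * M 0 1 + a' * M 1 2%:R) * (b * M 0 1 + b' * M 1 2%:R) * 2^-1).

Definition heis_hom_inv (a b c a' b' c' : R) (M : M3) : M3 :=
  let D := (a * b' - a' * b)^-1 in
  hpt (D * (b' * M 0 1 - a' * M 1 2%:R)) (D * (a * M 1 2%:R - b * M 0 1))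
    (D * (M 0 2%:R - M 0 1 * M 1 2%:R * 2^-1
          - (c * (D * (b' * M 0 1 - a' * M 1 2%:R))
             + c' * (D * (a * M 1 2%:R - b * M 0 1))))
     + (D * (b' * M 0 1 - a' * M 1 2%:R))
       * (D * (a * M 1 2%:R - b * M 0 1)) * 2^-1).

Lemma smooth_heis_hom a b c a' b' c' : smooth setT (heis_hom a b c a' b' c').
Proof.
have oT : open (setT : set M3) := openT.
by apply: smooth_hpt; smooth_real oT.
Qed.

Lemma smooth_heis_hom_inv a b c a' b' c' :
  smooth setT (heis_hom_inv a b c a' b' c').
Proof.
have oT : open (setT : set M3) := openT.
by apply: smooth_hpt; smooth_real oT.
Qed.

Lemma heis_homM a b c a' b' c' g h : H g -> H h ->
  heis_hom a b c a' b' c' (g *m h) =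
  heis_hom a b c a' b' c' g *m heis_hom a b c a' b' c' h.
Proof.
move=> /heisenbergP[x [y [z ->]]] /heisenbergP[u [v [w ->]]].
rewrite hptM /heis_hom hptM !hptE.
by apply: eq_hpt; [ring|ring|field].
Qed.

Lemma diffeomorphism_heis_hom a b c a' b' c' : a * b' - a' * b != 0 ->
  diffeomorphism (H : set M3) (H : set M3) (heis_hom a b c a' b' c').
Proof.
move=> D0; split.
- exact: smooth_smooth_map (@subsetT _ _) (smooth_heis_hom _ _ _ _ _ _).
- by move=> M _; exact: heisenberg_hpt.
exists (heis_hom_inv a b c a' b' c'); split.
- exact: smooth_smooth_map (@subsetT _ _) (smooth_heis_hom_inv _ _ _ _ _ _).
- by move=> M _; exact: heisenberg_hpt.
- move=> M /heisenbergP[x [y [z ->]]].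
  by rewrite /heis_hom_inv /heis_hom !hptE; apply: eq_hpt; field.
- move=> M /heisenbergP[x [y [z ->]]].
  by rewrite /heis_hom_inv /heis_hom !hptE; apply: eq_hpt; field.
Qed.

Lemma differential_heis_hom a b c a' b' c' p u v t : H p ->
  differential (H : set M3) (heis_hom a b c a' b' c') p (p *m hvec u v t) =
  heis_hom a b c a' b' c' p *m
    hvec (a * u + a' * v) (b * u + b' * v)
      ((a * b' - a' * b) * t + c * u + c' * v).
Proof.
move=> Hp; have tp : tangent (H : set M3) p (p *m hvec u v t).
  apply/(tangent_heisenberg _ Hp); apply: heis_alg_mul => //.
  exact: heis_alg_hvec.
have sh := smooth_heis_hom a b c a' b' c'.
rewrite (differential_smooth Hp Logic.I sh tp).
apply: (proj2 (_ : has_diff _ _ _ _)); apply: has_diff_eq.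
  by apply: has_diff_hpt; has_diff_real.
have [x [y [z ->]]] := heisenbergP Hp.
rewrite !hpt_hvec (hptE x y z) !(hvecE u).
by apply: eq_hvec; field.
Qed.

Lemma invariant_CR_unique (W : M3 -> set (M3 * M3)) :
  CR_structure (H : set M3) W ->
  left_invariant (H : set M3) (@mulmx R 3 3 3) W ->
  exists phi : M3 -> M3, lie_automorphism (H : set M3) (@mulmx R 3 3 3) phi /\
    CR_equivalence (H : set M3) (@heisenberg_V R) H W phi.
Proof.
move=> CW iW; have [[w1 w2] [/= w1H w2H WE]] := invariant_CR_line CW iW.
move: w1H w2H WE => [a [b [c ->]]] [a' [b' [c' ->]]] WE.
have [_ _ _ /(bracket_generating_det WE) D0] := CW.
have dphi := diffeomorphism_heis_hom c c' D0.
exists (heis_hom a b c a' b' c'); split.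
  by split=> // g h; exact: heis_homM.
have VE q (Hq : H q) := esym (heisenberg_VE Hq).
apply: (CR_equivalence_eq VE (fun q Hq => esym (WE q Hq))).
apply: invariant_line_equivalence => //= p Hp;
rewrite differential_heis_hom //; congr (_ *m _); apply: eq_hvec; ring.
Qed.

End HeisenbergCR.

(** * The quadric *)

Section Quadric.
Variable R : realType.
Local Notation H := (@heisenberg R).
Local Notation M3 := ('M[R]_3 : normedModType R).

Let fdM : finite_dim M3 := finite_dim_mx R 3 3.

Lemma quadricE (p : C2 R) : quadric p <-> p.1.2 = p.2.1 ^+ 2 + p.2.2 ^+ 2.
Proof.
rewrite /quadric /= -complexIm -add_Re2_Im2 /=; split=> [|-> //].
exact: complexI.
Qed.

Lemma quadric_mulE (z w : C2 R) : quadric_mul z w =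
  ((z.1.1 + w.1.1 - 2 * (z.2.1 * w.2.2 - z.2.2 * w.2.1),
    z.1.2 + w.1.2 + 2 * (z.2.1 * w.2.1 + z.2.2 * w.2.2)),
   (z.2.1 + w.2.1, z.2.2 + w.2.2)).
Proof.
case: z w => [[a b] [c d]] [[a' b'] [c' d']].
rewrite /quadric_mul /mkC2 /z1 /z2 -complexiE /=.
congr ((_, _), _) => //=; ring.
Qed.

(** Both components [z2 = x + i y] and [z1 = 2 x y - 4 z + i (x ^ 2 + y ^ 2)]
    are annihilated by the left-invariant field
    [L = d/dx + i (d/dy + x d/dz)].  The real part of [z1] is [-4] times the
    exponential coordinate [z - x y / 2], whose cocycle
    [(x y' - y x') / 2] is, up to that factor, the one of the product on the
    quadric. *)
Definition quadric_map (M : M3) : C2 R :=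
  ((2 * (M 0 1 * M 1 2%:R) - 4 * M 0 2%:R,
    M 0 1 * M 0 1 + M 1 2%:R * M 1 2%:R),
   (M 0 1, M 1 2%:R)).

Definition quadric_map_inv (p : C2 R) : M3 :=
  hpt p.2.1 p.2.2 ((2 * (p.2.1 * p.2.2) - p.1.1) * 4^-1).

Lemma smooth_quadric_map : smooth setT quadric_map.
Proof.
have oT : open (setT : set M3) := openT.
by apply: smooth_C2; smooth_real oT.
Qed.

Lemma smooth_quadric_map_inv : smooth setT quadric_map_inv.
Proof.
have oT : open (setT : set (C2 R)) := openT.
by apply: smooth_hpt; smooth_real oT.
Qed.

Lemma quadric_map_hpt x y z :
  quadric_map (hpt x y z) = ((2 * (x * y) - 4 * z, x * x + y * y), (x, y)).
Proof. by rewrite /quadric_map !(hptE x y z). Qed.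

Lemma quadric_mapM g h : H g -> H h ->
  quadric_map (g *m h) = quadric_mul (quadric_map g) (quadric_map h).
Proof.
move=> /heisenbergP[x [y [z ->]]] /heisenbergP[u [v [w ->]]].
by rewrite hptM !quadric_map_hpt quadric_mulE /=; congr ((_, _), _); ring.
Qed.

Lemma diffeomorphism_quadric_map :
  diffeomorphism (H : set M3) (quadric : set (C2 R)) quadric_map.
Proof.
split; first exact: smooth_smooth_map (@subsetT _ _) smooth_quadric_map.
  move=> g /heisenbergP[x [y [z ->]]]; apply/quadricE.
  by rewrite quadric_map_hpt /= !expr2.
exists quadric_map_inv; split.
- exact: smooth_smooth_map (@subsetT _ _) smooth_quadric_map_inv.
- by move=> p _; exact: heisenberg_hpt.
- move=> g /heisenbergP[x [y [z ->]]]; rewrite quadric_map_hpt /quadric_map_inv.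
  by apply: eq_hpt => //=; field.
- move=> [[a b] [c d]] /quadricE /= ->; rewrite quadric_map_hpt /= !expr2.
  by congr ((_, _), _); field.
Qed.

Lemma differential_quadric_map x y z a b c :
  differential (H : set M3) quadric_map (hpt x y z) (hvec a b c) =
  ((2 * (a * y + x * b) - 4 * c, 2 * (a * x + b * y)), (a, b)).
Proof.
have Hp := heisenberg_hpt x y z.
have tp : tangent (H : set M3) (hpt x y z) (hvec a b c).
  by apply/(tangent_heisenberg _ Hp); exact: heis_alg_hvec.
rewrite (differential_smooth Hp Logic.I smooth_quadric_map tp).
apply: (proj2 (_ : has_diff _ _ _ _)); apply: has_diff_eq.
  by apply: has_diff_C2; has_diff_real.
cbv beta; rewrite !(hptE x y z) !(hvecE a b c).
by congr ((_, _), _); ring.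
Qed.

(** The image of a complex tangent vector [a X + b Y + c Z], written in the
    left-invariant frame, is of type (0,1) if and only if the vector annihilates
    the functions [z2] and [z1].  The first equation says [b = i a] and the second
    then says [c = 0], which leaves the line of [L]. *)
Lemma CR_equivalence_quadric :
  CR_equivalence (H : set M3) (@heisenberg_V R) quadric (induced_CR quadric)
    quadric_map.
Proof.
have dF := diffeomorphism_quadric_map; split=> // p Hp.
have [sF FH _] := dF; rewrite heisenberg_VE //; apply/seteqP; split.
  move=> _ [w Lw <-].
  have [t1 t2] := @invariant_line_ctangent _ (heis_L R) _
    (heis_alg_hvec 1 0 0) (heis_alg_hvec 0 1 0) Hp _ Lw.
  split; first by split; exact: (tangent_differential fdM sF FH Hp).
  apply/T01E; case: Lw => k _ <-; have [x [y [z ->]]] := heisenbergP Hp.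
  rewrite cdifferential_scale /cdifferential /= !hpt_hvec.
  rewrite !differential_quadric_map /cplx_scale JE /=.
  by congr ((_, _), (_, _)) => /=; rewrite -?[_ *: _]/(_ * _); ring.
move=> w [[t1 t2] /T01E Jw]; have fd2 := finite_dim_C2 R.
have [v1 tv1 e1] := diffeomorphism_tangent_onto fdM fd2 dF Hp t1.
have [v2 tv2 e2] := diffeomorphism_tangent_onto fdM fd2 dF Hp t2.
exists (v1, v2); last by rewrite /cdifferential /= e1 e2; case: (w).
move: Jw; rewrite -e1 -e2 JE.
have [a [b [c ->]]] := (tangent_heisenberg _ Hp).1 tv1.
have [a' [b' [c' ->]]] := (tangent_heisenberg _ Hp).1 tv2.
have [x [y [z ->]]] := heisenbergP Hp; rewrite !differential_quadric_map /=.
move=> [h1 h2 h3 h4]; exists (Complex a (- b)) => //.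
rewrite /invariant_field /= !hpt_hvec /cplx_scale /= -!scaleNr !hvec_comb.
by rewrite h3 h4 in h1 h2 *; congr pair; apply: eq_hvec; lra.
Qed.

End Quadric.

(** * The punctured sphere *)

Section Cayley.
Variable R : realType.
Local Notation H := (@heisenberg R).
Local Notation M3 := ('M[R]_3 : normedModType R).

Lemma S3E (p : C2 R) :
  S3 p <-> p.1.1 ^+ 2 + p.1.2 ^+ 2 + (p.2.1 ^+ 2 + p.2.2 ^+ 2) = 1.
Proof.
rewrite /S3 /= -!add_Re2_Im2 -rmorphD /=; split=> [|-> //].
by move=> e; apply: complexI.
Qed.

Definition cayley_denom (p : C2 R) : R^o :=
  p.1.1 * p.1.1 + (p.1.2 + 1) * (p.1.2 + 1).

(** The Cayley transform [((z1 - i) / (z1 + i), 2 z2 / (z1 + i))], with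
    [cayley_denom] the square of the modulus of [z1 + i].  It carries the
    quadric to the sphere since
    [|z1 + i| ^ 2 - |z1 - i| ^ 2 = 4 Im z1]. *)
Definition cayley (p : C2 R) : C2 R :=
  ((1 - 2 * ((p.1.2 + 1) * (cayley_denom p)^-1),
    - 2 * (p.1.1 * (cayley_denom p)^-1)),
   (2 * ((p.2.1 * p.1.1 + p.2.2 * (p.1.2 + 1)) * (cayley_denom p)^-1),
    2 * ((p.2.2 * p.1.1 - p.2.1 * (p.1.2 + 1)) * (cayley_denom p)^-1))).

Definition cayley_inv_denom (p : C2 R) : R^o :=
  (1 - p.1.1) * (1 - p.1.1) + p.1.2 * p.1.2.

(** In complex notation, [(i (1 + w1) / (1 - w1), i w2 / (1 - w1))]. *)
Definition cayley_inv (p : C2 R) : C2 R :=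
  ((- 2 * (p.1.2 * (cayley_inv_denom p)^-1),
    2 * ((1 - p.1.1) * (cayley_inv_denom p)^-1) - 1),
   (- 1 * ((p.2.1 * p.1.2 + p.2.2 * (1 - p.1.1)) * (cayley_inv_denom p)^-1),
    (p.2.1 * (1 - p.1.1) - p.2.2 * p.1.2) * (cayley_inv_denom p)^-1)).

Definition cayley_dom : set (C2 R) :=
  setT `&` cayley_denom @^-1` [set t | t != 0].

Definition cayley_inv_dom : set (C2 R) :=
  setT `&` cayley_inv_denom @^-1` [set t | t != 0].

Definition cayley_pole : C2 R := ((1, 0), (0, 0)).

Lemma open_nonzero : open [set t : R^o | t != 0].
Proof.
have -> : [set t : R^o | t != 0] = ~` [set 0].
  by apply/seteqP; split=> t /eqP.
exact/closed_openC/closed_eq.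
Qed.

Lemma smooth_cayley_denom (U : set (C2 R)) : open U -> smooth U cayley_denom.
Proof. by move=> oU; rewrite /cayley_denom; smooth_real oU. Qed.

Lemma smooth_cayley_inv_denom (U : set (C2 R)) :
  open U -> smooth U cayley_inv_denom.
Proof. by move=> oU; rewrite /cayley_inv_denom; smooth_real oU. Qed.

Lemma smooth_cayley : smooth cayley_dom cayley.
Proof.
have oD : open cayley_dom.
  exact: open_smooth_preimage (smooth_cayley_denom openT) open_nonzero.
have si : smooth cayley_dom (fun p => (cayley_denom p : R)^-1 : R^o).
  by apply: smooth_inv (smooth_cayley_denom oD) _ => p [].
by apply: smooth_C2; smooth_real oD.
Qed.

Lemma smooth_cayley_inv : smooth cayley_inv_dom cayley_inv.
Proof.
have oD : open cayley_inv_dom.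
  exact: open_smooth_preimage (smooth_cayley_inv_denom openT) open_nonzero.
have si : smooth cayley_inv_dom (fun p => (cayley_inv_denom p : R)^-1 : R^o).
  by apply: smooth_inv (smooth_cayley_inv_denom oD) _ => p [].
by apply: smooth_C2; smooth_real oD.
Qed.

Lemma diff_cayley p v : cayley_dom p ->
  let r := (cayley_denom p)^-1 in
  let dr := - 2 * (p.1.1 * v.1.1 + (p.1.2 + 1) * v.1.2) * r ^+ 2 in
  'd cayley p v =
  ((- 2 * (v.1.2 * r + (p.1.2 + 1) * dr), - 2 * (v.1.1 * r + p.1.1 * dr)),
   (2 * ((v.2.1 * p.1.1 + p.2.1 * v.1.1
          + v.2.2 * (p.1.2 + 1) + p.2.2 * v.1.2) * r
         + (p.2.1 * p.1.1 + p.2.2 * (p.1.2 + 1)) * dr),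
    2 * ((v.2.2 * p.1.1 + p.2.2 * v.1.1
          - v.2.1 * (p.1.2 + 1) - p.2.1 * v.1.2) * r
         + (p.2.2 * p.1.1 - p.2.1 * (p.1.2 + 1)) * dr))).
Proof.
move=> [_ /= N0].
have h1 u := has_diff_mulr (has_diff_re1 p u) (has_diff_re1 p u).
have h2 u := has_diff_addr (has_diff_im1 p u) (has_diff_cst (1 : R^o) p u).
have hN u := has_diff_inv N0
  (has_diff_addr (h1 u) (has_diff_mulr (h2 u) (h2 u))
   : has_diff cayley_denom p u _).
apply: (proj2 (_ : has_diff _ _ _ _)); apply: has_diff_eq.
  by apply: has_diff_C2; repeat first [exact: hN | progress has_diff_real].
by cbv beta; congr ((_, _), (_, _)); ring.
Qed.

Lemma diff_cayleyJ p v : cayley_dom p -> 'd cayley p (J v) = J ('d cayley p v).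
Proof.
move=> dp; have [_ /= N0] := dp; rewrite !diff_cayley // !JE /=.
rewrite /cayley_denom in N0 *.
by congr ((_, _), (_, _)); field.
Qed.

Lemma cayleyK p :
  cayley_dom p -> cayley_inv_dom (cayley p) /\ cayley_inv (cayley p) = p.
Proof.
move=> [_ /= N0]; have N0' := N0; rewrite /cayley_denom in N0'.
have dE : cayley_inv_denom (cayley p) = 4 * (cayley_denom p)^-1.
  by rewrite /cayley_inv_denom /cayley /cayley_denom /=; field.
split; first by split=> //=; rewrite dE mulf_neq0 ?invr_neq0 ?pnatr_eq0.
case: p N0 N0' dE => [[a b] [c d]] /= N0 N0' dE.
rewrite /cayley_inv dE /cayley /cayley_denom /=.
by congr ((_, _), (_, _)); field.
Qed.

Lemma quadric_cayley_dom : quadric `<=` cayley_dom.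
Proof.
move=> p /quadricE e; split=> //=; rewrite /cayley_denom -!expr2 e.
rewrite gt_eqF // ltr_wpDl ?sqr_ge0 // exprn_gt0 //.
by rewrite ltr_wpDl // addr_ge0 ?sqr_ge0.
Qed.

Lemma sphere_cayley_inv_dom : S3 `\ cayley_pole `<=` cayley_inv_dom.
Proof.
move=> p [/S3E e pn]; split=> //=; rewrite /cayley_inv_denom -!expr2.
apply/eqP => /eqP; rewrite paddr_eq0 ?sqr_ge0 // !sqrf_eq0 subr_eq0.
move=> /andP[/eqP a1 /eqP b0]; apply: pn.
case: p e a1 b0 => [[a b] [c d]] /= e a1 b0.
move: e; rewrite -a1 b0 expr1n expr0n addr0 => e.
have /eqP : c ^+ 2 + d ^+ 2 = 0 by lra.
by rewrite paddr_eq0 ?sqr_ge0 // !sqrf_eq0 => /andP[/eqP -> /eqP ->].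
Qed.

Lemma cayley_quadric p : quadric p -> (S3 `\ cayley_pole) (cayley p).
Proof.
move=> Qp; have [_ /= N0] := quadric_cayley_dom Qp; move/quadricE: Qp => e.
split.
  by apply/S3E; rewrite /cayley /= /cayley_denom e in N0 *; field.
move=> /(congr1 (fun q : C2 R => q.1.1)) /= h.
have : (p.1.2 + 1) * (cayley_denom p)^-1 = 0 by lra.
move/eqP; rewrite mulf_eq0 invr_eq0 (negbTE N0) orbF e gt_eqF //.
by rewrite ltr_wpDl // addr_ge0 ?sqr_ge0.
Qed.

Lemma cayley_inv_sphere p : (S3 `\ cayley_pole) p ->
  quadric (cayley_inv p) /\ cayley (cayley_inv p) = p.
Proof.
move=> Sp; have [_ /= N0] := sphere_cayley_inv_dom Sp.
have [/S3E e _] := Sp; have N0' := N0; rewrite /cayley_inv_denom in N0'.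
split.
  have e2 : p.2.1 ^+ 2 + p.2.2 ^+ 2 = 1 - p.1.1 ^+ 2 - p.1.2 ^+ 2 by lra.
  have imE : (cayley_inv p).1.2 =
      (p.2.1 ^+ 2 + p.2.2 ^+ 2) * (cayley_inv_denom p)^-1.
    by rewrite e2 /cayley_inv /cayley_inv_denom /=; field.
  apply/quadricE; rewrite imE /cayley_inv /cayley_inv_denom /=.
  by field.
have dE : cayley_denom (cayley_inv p) = 4 * (cayley_inv_denom p)^-1.
  by rewrite /cayley_denom /cayley_inv /cayley_inv_denom /=; field.
case: p Sp N0 N0' dE {e} => [[a b] [c d]] /= Sp N0 N0' dE.
rewrite /cayley dE /cayley_inv /cayley_inv_denom /=.
by congr ((_, _), (_, _)); field.
Qed.

Lemma CR_equivalence_cayley :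
  CR_equivalence quadric (induced_CR quadric)
    (S3 `\ cayley_pole) (induced_CR (S3 `\ cayley_pole)) cayley.
Proof.
exact: induced_CR_equivalence quadric_cayley_dom sphere_cayley_inv_dom
  smooth_cayley smooth_cayley_inv cayleyK cayley_quadric cayley_inv_sphere
  diff_cayleyJ.
Qed.

Lemma CR_equivalence_punctured_sphere :
  CR_equivalence (H : set M3) (@heisenberg_V R) (S3 `\ cayley_pole)
    (induced_CR (S3 `\ cayley_pole)) (cayley \o @quadric_map R).
Proof.
apply: CR_equivalence_comp (finite_dim_mx R 3 3) (finite_dim_C2 R) _
  (CR_equivalence_quadric R) CR_equivalence_cayley.
move=> p Hp; rewrite heisenberg_VE //.
by apply: invariant_line_ctangent => //; exact: heis_alg_hvec.
Qed.

Lemma spherical_heisenberg : spherical (H : set M3) (@heisenberg_V R).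
Proof.
move=> p Hp.
exists setT, (~` [set cayley_pole]), (cayley \o @quadric_map R).
split; [exact: openT|by []| |].
  apply/closed_openC/accessible_closed_set1/hausdorff_accessible.
  exact: norm_hausdorff.
by rewrite setIT; exact: CR_equivalence_punctured_sphere.
Qed.

End Cayley.

Theorem proposition6p1 (R : realType) :
  let H : set 'M[R]_3 := heisenberg in
  let V : 'M[R]_3 -> set ('M[R]_3 * 'M[R]_3) := heisenberg_V in
  (* (a) *)
  [/\ CR_structure H V, left_invariant H (@mulmx R 3 3 3) V &
      forall W : 'M[R]_3 -> set ('M[R]_3 * 'M[R]_3),
        CR_structure H W -> left_invariant H (@mulmx R 3 3 3) W ->
        exists phi : 'M[R]_3 -> 'M[R]_3,
          lie_automorphism H (@mulmx R 3 3 3) phi /\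
          CR_equivalence H V H W phi] /\
  (* (b) *)
  (spherical H V /\
   exists (p : C2 R) (f : 'M[R]_3 -> C2 R),
     S3 p /\ CR_equivalence H V (S3 `\ p) (induced_CR (S3 `\ p)) f) /\
  (* (c) *)
  (exists f : 'M[R]_3 -> C2 R,
     CR_equivalence H V quadric (induced_CR quadric) f /\
     forall g h, H g -> H h -> f (g *m h) = quadric_mul (f g) (f h)).
Proof.
move=> H V; split; [|split].
- split; [exact: CR_structure_heisenberg|exact: left_invariant_heisenberg|].
  exact: invariant_CR_unique.
- split; first exact: spherical_heisenberg.
  exists (cayley_pole R), (cayley (R := R) \o @quadric_map R); split.
    by apply/S3E; rewrite /= expr1n !expr0n !addr0.
  exact: CR_equivalence_punctured_sphere.
- exists (@quadric_map R); split; first exact: CR_equivalence_quadric.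
  exact: quadric_mapM.
Qed.
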